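(* For every $1<q<\infty$ one has $H^1_0(B^c)\cap L^1_{d\mu}\subset L^q_{d\mu}$, and there exists a constant $C>0$ (depending on $q$) such that $$\|f\|_{L^q_{d\mu}}\le C\,\|\nabla f\|_{L^2(B^c)}^{1-\frac1q}\,\|f\|_{L^1_{d\mu}}^{\frac1q}\qquad\text{for all } f\in H^1_0(B^c)\cap L^1_{d\mu}.$$
   Context: Let $B=\{x\in\mathbb R^2:|x|\le1\}$ and $B^c=\mathbb R^2\setminus B$. The measure $d\mu$ is $d\mu=(1+\log|x|)\,dx$ on $B^c$, and for $1\le q<\infty$, $L^q_{d\mu}=\{f\in L^q(B^c):\|f\|_{L^q_{d\mu}}<\infty\}$ with $\|f\|_{L^q_{d\mu}}=\big(\int_{B^c}|f|^q\,d\mu\big)^{1/q}$. Functions are real-valued; no radial symmetry is assumed. *)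

(* Defs.v *)
From HB Require Import structures.
From mathcomp Require Import all_boot all_order all_algebra.
From mathcomp Require Import all_classical all_reals all_analysis.
From mathcomp Require Import measurable_realfun.

Set Implicit Arguments.
Unset Strict Implicit.
Unset Printing Implicit Defensive.

Import Order.TTheory GRing.Theory Num.Theory.
Import numFieldNormedType.Exports.

Local Open Scope classical_set_scope.
Local Open Scope ring_scope.

Section exterior_domain.
Context {R : realType}.

(* [R * R] with the Borel sigma-algebra that [lebesgue_measure] carries. *)
Local Notation plane := (measurableTypeR R * measurableTypeR R)%type.

(* The norm carried by the product type [R * R] is the max norm. *)
Definition enorm (x : R * R) : R := Num.sqrt (x.1 ^+ 2 + x.2 ^+ 2).

Definition disc : set (R * R) := [set x | enorm x <= 1].

Definition ext : set (R * R) := ~` disc.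

Lemma measurable_enorm : measurable_fun [set: plane] enorm.
Proof.
apply: (measurableT_comp (f := @Num.sqrt R)).
  by apply: continuous_measurable_fun; exact: sqrt_continuous.
by apply: measurable_funD; apply: measurable_funX;
  [exact: measurable_fst|exact: measurable_snd].
Qed.

Lemma measurable_ext : measurable (ext : set plane).
Proof.
apply: measurableC; rewrite -[disc]setTI.
rewrite (_ : disc = enorm @^-1` `]-oo, 1]).
  by apply: measurable_enorm => //; exact: measurable_itv.
by apply/seteqP; split => x; rewrite /disc /= in_itv.
Qed.

Definition leb2 : set plane -> \bar R :=
  (@lebesgue_measure R \x @lebesgue_measure R)%E.

HB.instance Definition _ := Measure.on leb2.

(* L^q(B^c) is [Lfun leb_ext q]: functions are defined on the whole plane,
   but [leb_ext] does not see their values on [disc]. *)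
Definition leb_ext : set plane -> \bar R := mrestr leb2 measurable_ext.

HB.instance Definition _ := Measure.on leb_ext.

Definition mu_log (A : set plane) : \bar R :=
  (\int[leb2]_(x in A `&` ext) (1 + ln (enorm x))%:E)%E.

Let mu_log0 : mu_log set0 = 0%E.
Proof. by rewrite /mu_log set0I integral_set0. Qed.

Let weight_ge0 x : ext x -> (0 <= (1 + ln (enorm x))%:E)%E.
Proof.
move=> /negP; rewrite -ltNge => x1.
by rewrite lee_fin addr_ge0// ln_ge0// ltW.
Qed.

Let mu_log_ge0 A : (0 <= mu_log A)%E.
Proof. by apply: integral_ge0 => x [_]; exact: weight_ge0. Qed.

Let mu_log_semi_sigma_additive : semi_sigma_additive mu_log.
Proof.
move=> F mF tF mUF; rewrite /mu_log setI_bigcupl ge0_integral_bigcup//=.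
- by apply: is_cvg_ereal_nneg_natsum_cond => n _ _; exact: mu_log_ge0.
- by move=> k; apply: measurableI => //; exact: measurable_ext.
- apply/measurable_EFinP; apply: measurable_funTS; apply: measurable_funD => //.
  by apply: measurableT_comp => //; exact: measurable_enorm.
- by move=> x [k _ [_]]; exact: weight_ge0.
- apply/trivIsetP => i j _ _ ij; move/trivIsetP : tF => /(_ i j I I ij).
  by rewrite setIACA => ->; rewrite set0I.
Qed.

HB.instance Definition _ := isMeasure.Build _ _ _ mu_log
  mu_log0 mu_log_ge0 mu_log_semi_sigma_additive.

Definition e1 : R * R := (1, 0).
Definition e2 : R * R := (0, 1).

Fixpoint iter_partial (s : seq bool) (f : R * R -> R) : R * R -> R :=
  if s is b :: s' then 'D_(if b then e1 else e2) (iter_partial s' f) else f.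

Definition smooth (f : R * R -> R) := forall s : seq bool,
  [/\ continuous (iter_partial s f),
      forall x, derivable (iter_partial s f) x e1 &
      forall x, derivable (iter_partial s f) x e2].

(* C_c^oo(B^c), each function being extended by 0 to the plane. *)
Definition test_fun (phi : R * R -> R) :=
  let supp := closure [set x | phi x != 0] in
  [/\ smooth phi, compact supp & supp `<=` ext].

Definition grad (phi : R * R -> R) (x : R * R) : R * R :=
  ('D_e1 phi x, 'D_e2 phi x).

(* f belongs to H^1(B^c) and g is its weak gradient. *)
Definition H1_grad (f : R * R -> R) (g : R * R -> R * R) :=
  [/\ f \in Lfun leb_ext 2%:E,
      (fst \o g \in Lfun leb_ext 2%:E) /\ (snd \o g \in Lfun leb_ext 2%:E) &
      forall phi, test_fun phi ->
        (\int[leb_ext]_x (f x * 'D_e1 phi x)%:E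
           = - \int[leb_ext]_x ((g x).1 * phi x)%:E)%E /\
        (\int[leb_ext]_x (f x * 'D_e2 phi x)%:E
           = - \int[leb_ext]_x ((g x).2 * phi x)%:E)%E].

Definition L2norm_grad (g : R * R -> R * R) : \bar R :=
  'N[leb_ext]_2%:E[EFin \o (enorm \o g)]%E.

(* The H^1 norm of a function whose weak gradient is g. *)
Definition H1norm (f : R * R -> R) (g : R * R -> R * R) : \bar R :=
  (('N[leb_ext]_2%:E[EFin \o f] `^ 2 + L2norm_grad g `^ 2) `^ 2^-1)%E.

(* The closure of C_c^oo(B^c) in H^1(B^c). As the weak gradient g of f is
   unique up to a null set, the choice of g is immaterial. *)
Definition H10 (f : R * R -> R) :=
  (exists g, H1_grad f g) /\
  exists2 phi : nat -> R * R -> R, forall n, test_fun (phi n) &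
    forall g, H1_grad f g ->
      H1norm (phi n \- f) (grad (phi n) \- g) @[n --> \oo] --> 0%E.

End exterior_domain.

(* Main.v *)
Require Import Defs.
From mathcomp Require Import all_boot all_order all_algebra.
From mathcomp Require Import all_classical all_reals all_analysis.
From mathcomp Require Import measurable_realfun ring lra.

Set Implicit Arguments.
Unset Strict Implicit.
Unset Printing Implicit Defensive.

Import Order.TTheory GRing.Theory Num.Theory.
Import numFieldNormedType.Exports.

Local Open Scope classical_set_scope.
Local Open Scope ring_scope.

(** Write [s = |x|^2].  On the exterior of the disc the weight [1 + log |x|] is
    comparable to [lg s = 1 + ln (1 + s)], which is smooth on the whole plane,
    so [lg] replaces it throughout.

    Smooth compactly supported functions.  The Gagliardo inequality
    [int u^2 <= int |d_1 u| * int |d_2 u|] (each value of [u] is bounded by the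
    integral of a partial derivative along a line; then Fubini) is applied to
    [u = phi^(k+1) * sqrt (lg s)].  Each partial derivative of [u] is the product
    of [phi^k * sqrt (lg s)] with a cofactor made of [(k+1) d_i phi] and of
    [phi] times a quantity bounded by [1 / (sqrt (1 + s) * lg s)].  The
    square of the cofactor is integrable with a bound by [int |grad phi|^2]:
    this is the critical Hardy inequality in the plane, valid because [phi]
    vanishes on the disc ([hardy_inequality]).  Cauchy-Schwarz then gives
    [A_(k+1) <= C_k * |grad phi|_2^2 * A_k] for
    [A_k = int phi^(2k) lg s] ([integral_exp_step]).  To start the recursion,
    [phi^2 <= t |phi| + t^-2 phi^4] and the step from [A_1] to [A_2] bound [A_1]
    by [|grad phi|_2 * int |phi| lg s], the term in [A_2] being absorbed for a
    suitable [t].  Hence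
    [A_k <= D_k * |grad phi|_2^(2k-1) * int |phi| lg s] ([test_fun_moment]).

    Passing to the closure.  Convergence of test functions to [f] in [H^1] does not
    control weighted [L^1] norms, because the weight is not square integrable.
    Everything is therefore done with the weight [lg s / (1 + d s)^2], which is
    square integrable for [d > 0]: the damping factor has logarithmic derivative
    at most of order [sqrt d], which only adds [d * int phi^2] to the Dirichlet
    integral.  For fixed [d], and with [f] truncated at height [K], the estimate
    passes to the limit ([truncated_moment]); then [d -> 0] and [K -> oo] by
    monotone convergence ([weighted_moment]).

    Conclusion.  The pointwise interpolation
    [x^q <= t^(q-1) x + t^(q-n) x^n], for [q <= n] and [t] of the size of the
    norm of the gradient, reduces the exponent [q] to [1] and to a large even
    integer [n]. *)

(** * Integration *)

Section measure_generalities.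
Import HBNNSimple.
Context d (T : measurableType d) (R : realType).
Implicit Types mu nu : {measure set T -> \bar R}.
Local Open Scope ereal_scope.

(** Integration against a measure given by a density: the exterior Lebesgue
    measure has density [1], the logarithmic one [1 + ln (enorm x)], both with
    respect to the plane Lebesgue measure. *)
Lemma ge0_integral_density mu nu (D : set T) (w : T -> R) (f : T -> \bar R) :
  measurable D -> measurable_fun D w -> (forall x, D x -> (0 <= w x)%R) ->
  (forall A, measurable A -> nu A = \int[mu]_(x in A `&` D) (w x)%:E) ->
  measurable_fun setT f -> (forall x, 0 <= f x) ->
  \int[nu]_x f x = \int[mu]_(x in D) (f x * (w x)%:E).
Proof.
move=> mD mw w0 nuE mf f0.
have mwE : measurable_fun D (EFin \o w) by exact/measurable_EFinP.
pose h := nnsfun_approx measurableT mf.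
have hf x : (fun n => (h n x)%:E) @ \oo --> f x by exact: cvg_nnsfun_approx.
have hnd x : {homo (fun n => h n x) : m n / (m <= n)%N >-> (m <= n)%R}.
  by move=> m n mn; exact/lefP/nd_nnsfun_approx.
transitivity (limn (fun n => \int[nu]_x (h n x)%:E)).
  rewrite -monotone_convergence//=.
  - by apply: eq_integral => x _; apply/esym/cvg_lim => //; exact: hf.
  - by move=> n; exact/measurable_EFinP.
  - by move=> n x _; rewrite lee_fin.
  - by move=> x _ m n mn; rewrite lee_fin; exact: hnd.
transitivity (limn (fun n => \int[mu]_(x in D) ((h n x)%:E * (w x)%:E))); last first.
  rewrite -monotone_convergence//=.
  - apply: eq_integral => x _; apply/cvg_lim => //.
    by apply: cvgeZr => //; exact: hf.
  - move=> n; apply: emeasurable_funM => //; apply: measurable_funTS.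
    exact/measurable_EFinP.
  - by move=> n x Dx; rewrite mule_ge0 ?lee_fin ?w0.
  - move=> x Dx m n mn; rewrite lee_wpmul2r ?lee_fin ?w0//; exact: hnd.
congr (limn _); apply/funext => n.
under eq_integral do rewrite fimfunE -fsumEFin//.
rewrite ge0_integral_fsum//; last 2 first.
  - by move=> r; exact/measurable_EFinP/measurable_funM.
  - by move=> r x _; exact: nnfun_muleindic_ge0.
transitivity (\int[mu]_(x in D) (\sum_(y \in range (h n))
    (y * \1_(h n @^-1` [set y]) x)%:E * (w x)%:E)); last first.
  apply: eq_integral => x xD.
  rewrite -ge0_mule_fsuml => [|y]; last exact: nnfun_muleindic_ge0.
  by rewrite fsumEFin // -(fimfunE _ x).
rewrite ge0_integral_fsum//; last 2 first.
  - move=> y; apply: emeasurable_funM => //; apply: measurable_funTS.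
    exact/measurable_EFinP/measurable_funM.
  - by move=> r x Dx; rewrite mule_ge0 ?lee_fin ?w0//; exact: nnfun_muleindic_ge0.
apply: eq_fsbigr => r rhn.
under eq_integral do rewrite EFinM.
rewrite integralZl_indic_nnsfun => //.
under [RHS]eq_integral do rewrite EFinM -muleA.
rewrite ge0_integralZl//.
- under [in RHS]eq_integral do rewrite muleC.
  rewrite [in RHS](eq_integral ((EFin \o w) \_ (h n @^-1` [set r]))); last first.
    by move=> x xE; rewrite epatch_indic.
  by rewrite -integral_mkcondr integral_indic// setIT nuE// setIC.
- apply: emeasurable_funM => //; apply: measurable_funTS.
  exact/measurable_EFinP.
- by move=> t Et; rewrite mule_ge0 ?lee_fin ?w0.
- by move: rhn; rewrite inE => -[t _ <-]; rewrite lee_fin.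
Qed.

(** Cauchy-Schwarz in the form used below, where only upper bounds of the two
    square integrals are known. *)
Lemma integral_CauchySchwarz mu (a b : T -> R) (al be : R) :
  measurable_fun setT a -> measurable_fun setT b ->
  (0 <= al)%R -> (0 <= be)%R ->
  \int[mu]_x ((a x) ^+ 2)%:E <= al%:E ->
  \int[mu]_x ((b x) ^+ 2)%:E <= be%:E ->
  \int[mu]_x `|a x * b x|%:E <= (Num.sqrt (al * be))%:E.
Proof.
move=> ma mb al0 be0 Ia Ib.
have := @hoelder _ _ _ mu a b 2 2 ma mb.
rewrite Lnorm1 => /(_ _ _ _)/le_trans; apply => //; first by lra.
have N2 (c : T -> R) (ga : R) : (0 <= ga)%R -> \int[mu]_x ((c x) ^+ 2)%:E <= ga%:E ->
    'N[mu]_2%:E[EFin \o c] <= (Num.sqrt ga)%:E.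
  move=> ga0 Ic; rewrite -powR12_sqrt// -poweR_EFin unlock.
  have -> : \int[mu]_x `|(EFin \o c) x| `^ 2 = \int[mu]_x ((c x) ^+ 2)%:E.
    by apply: eq_integral => x _ /=; rewrite powR_mulrn// real_normK// num_real.
  apply: gt0_ler_poweR => //.
  - by rewrite in_itv/= leey andbT; apply: integral_ge0 => x _; rewrite lee_fin sqr_ge0.
  - by rewrite in_itv/= leey andbT lee_fin.
rewrite sqrtrM// EFinM; by apply: lee_pmul; rewrite ?Lnorm_ge0// N2.
Qed.

Local Close Scope ereal_scope.

Lemma ge0_le_integral_EFin mu (f g : T -> R) : measurable_fun setT f ->
  measurable_fun setT g -> (forall x, 0 <= f x) -> (forall x, f x <= g x) ->
  (\int[mu]_x (f x)%:E <= \int[mu]_x (g x)%:E)%E.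
Proof.
move=> mf mg f0 fg; apply: ge0_le_integral => //.
- by move=> x _; rewrite lee_fin.
- exact/measurable_EFinP.
- exact/measurable_EFinP.
- by move=> x _; rewrite lee_fin.
Qed.

Lemma ge0_integral_lin2_le mu (f g : T -> R) (c e a b : R) :
  0 <= c -> 0 <= e -> measurable_fun setT f -> measurable_fun setT g ->
  (forall x, 0 <= f x) -> (forall x, 0 <= g x) ->
  (\int[mu]_x (f x)%:E <= a%:E)%E -> (\int[mu]_x (g x)%:E <= b%:E)%E ->
  (\int[mu]_x (c * f x + e * g x)%:E <= (c * a + e * b)%:E)%E.
Proof.
move=> c0 e0 mf mg f0 g0 fa gb.
under eq_integral do rewrite EFinD.
rewrite ge0_integralD//.
- rewrite EFinD; apply: leeD.
    under eq_integral do rewrite EFinM.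
    by rewrite ge0_integralZl_EFin//; [rewrite EFinM lee_wpmul2l ?lee_fin|
      move=> x _; rewrite lee_fin|exact/measurable_EFinP].
  under eq_integral do rewrite EFinM.
  by rewrite ge0_integralZl_EFin//; [rewrite EFinM lee_wpmul2l ?lee_fin|
    move=> x _; rewrite lee_fin|exact/measurable_EFinP].
- by move=> x _; rewrite lee_fin mulr_ge0.
- by apply/measurable_EFinP; exact: measurable_funM.
- by move=> x _; rewrite lee_fin mulr_ge0.
- by apply/measurable_EFinP; exact: measurable_funM.
Qed.

End measure_generalities.

Section plane.
Context {R : realType}.
Local Notation plane := (measurableTypeR R * measurableTypeR R)%type.
Local Notation mu1 := (@lebesgue_measure R).

(** The measurable sets of the plane are those of the product sigma-algebra,
    so open sets have to be exhibited as countable unions of boxes. *)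
Lemma open_measurable_plane (U : set (R * R)) :
  open U -> measurable (U : set plane).
Proof.
move=> oU.
pose box (q : rat * rat * rat) : set (R * R) :=
  `]ratr q.1.1 - ratr q.2, ratr q.1.1 + ratr q.2[ `*`
  `]ratr q.1.2 - ratr q.2, ratr q.1.2 + ratr q.2[.
have -> : U = \bigcup_(q in [set q | box q `<=` U]) box q.
  apply/seteqP; split=> [[x y] Uxy|z [q /= qU /qU//]].
  move: oU; rewrite openE => /(_ _ Uxy) /nbhs_ballP[e /= e0 eU].
  have /rat_in_itvoo[r] : 0 < e / 2 by lra.
  rewrite in_itv/= => /andP[r0 re].
  have /rat_in_itvoo[a] : x - ratr r < x + ratr r by lra.
  rewrite in_itv/= => /andP[a1 a2].
  have /rat_in_itvoo[b] : y - ratr r < y + ratr r by lra.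
  rewrite in_itv/= => /andP[b1 b2].
  exists (a, b, r) => /=; last first.
    by rewrite /box; split => /=; rewrite in_itv/=; apply/andP; split; lra.
  move=> [u v] [] /=; rewrite !in_itv/= => /andP[u1 u2] /andP[v1 v2].
  by apply: eU; split; rewrite -ball_normE /ball_/= ltr_distl; apply/andP; split; lra.
rewrite bigcup_mkcond; apply: countable_bigcupT_measurable => // q.
by case: ifPn => // _; apply: measurableX; exact: measurable_itv.
Qed.

Lemma continuous_measurable_plane (f : R * R -> R) :
  continuous f -> measurable_fun [set: plane] f.
Proof.
move=> /continuousP cf; apply: (measurability _ (RGenOpens.measurableE R)).
move=> _ [_ [a [b ->] <-]]; rewrite setTI.
by apply: open_measurable_plane; apply: cf; exact: interval_open.
Qed.

Lemma integral_oneDsqr_lty : (\int[mu1]_x ((oneDsqr x)^-1)%:E < +oo)%E.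
Proof.
have mf : measurable_fun setT (fun x : R => ((oneDsqr x)^-1)%:E).
  apply/measurable_EFinP.
  apply: continuous_measurable_fun.
  exact: continuous_oneDsqrV.
have f0 (x : R) : (0 <= ((oneDsqr x)^-1)%:E)%E by rewrite lee_fin invr_ge0.
have I0 : (\int[mu1]_(x in `[0%R, +oo[) ((oneDsqr x)^-1)%:E < +oo)%E.
  by rewrite integral0y_oneDsqr ltry.
rewrite (_ : setT = `]-oo, 0%R[ `|` `[0%R, +oo[ :> set R); last first.
  apply/seteqP; split=> // x _ /=; rewrite !in_itv/= andbT.
  by case: (ltP x 0); [left|right].
rewrite ge0_integral_setU//=; last 2 first.
- exact: measurable_funTS.
- apply/eqP; rewrite -subset0 => x /= [].
  by rewrite !in_itv/= andbT => /lt_le_trans /[apply]; rewrite ltxx.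
rewrite lte_add_pinfty//.
apply: le_lt_trans I0; rewrite ge0_integration_by_substitution0//.
under [leRHS]eq_integral do rewrite /oneDsqr sqrrN.
apply: ge0_subset_integral => //.
- exact: measurable_funTS.
- by move=> x /=; rewrite !in_itv/=; exact: ltW.
Qed.

(** The integrable majorant behind the square integrability of the damped
    weight. *)
Lemma integral_oneDsqrX_lty :
  (\int[@leb2 R]_z ((oneDsqr z.1 * oneDsqr z.2)^-1)%:E < +oo)%E.
Proof.
have cV : measurable_fun setT (fun x : R => (oneDsqr x)^-1).
  exact: (continuous_measurable_fun (@continuous_oneDsqrV R)).
have f0 (x : R) : (0 <= ((oneDsqr x)^-1)%:E)%E by rewrite lee_fin invr_ge0.
have iV : mu1.-integrable setT (fun x => ((oneDsqr x)^-1)%:E).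
  apply/integrableP; split; first exact/measurable_EFinP.
  under eq_integral do rewrite gee0_abs//.
  exact: integral_oneDsqr_lty.
have [c Ic] : exists c : R, (\int[mu1]_x ((oneDsqr x)^-1)%:E = c%:E)%E.
  by exists (fine (\int[mu1]_x ((oneDsqr x)^-1)%:E)); rewrite fineK// integrable_fin_num.
have c0 : 0 <= c by rewrite -lee_fin -Ic; apply: integral_ge0.
rewrite /leb2 fubini_tonelli1//=; last first.
  apply/measurable_EFinP; under eq_fun do rewrite invfM.
  by apply: measurable_funM; apply: (measurableT_comp cV);
    [exact: measurable_fst|exact: measurable_snd].
rewrite /fubini_F/=.
under eq_integral => x _.
  under eq_integral do rewrite invfM EFinM.
  rewrite ge0_integralZl//; last exact/measurable_EFinP.
  rewrite Ic; over.
rewrite ge0_integralZr//; last exact/measurable_EFinP.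
by rewrite Ic ltry.
Qed.

End plane.
(** * Calculus on lines and on the plane *)

Section line.
Context {R : realType}.
Local Notation mu1 := (@lebesgue_measure R).
Implicit Types (F f : R -> R) (M : R).

Lemma is_derive_continuous F f : (forall t : R, is_derive t 1 F (f t)) ->
  continuous F.
Proof.
move=> Ff t; apply: differentiable_continuous; apply/derivable1_diffP.
by have [] := Ff t.
Qed.

Lemma integral_itv_is_derive F f a b : a < b ->
  (forall t : R, is_derive t 1 F (f t)) -> continuous f ->
  (\int[mu1]_(t in `[a, b]) (f t)%:E = (F b - F a)%:E)%E.
Proof.
move=> ab Ff cf; have cF := is_derive_continuous Ff.
rewrite (continuous_FTC2 (F := F) ab).
- by rewrite EFinB.
- exact: continuous_subspaceT.
- split.
  + by move=> t _; have [] := Ff t.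
  + by apply: cvg_at_right_filter; exact: cF.
  + by apply: cvg_at_left_filter; exact: cF.
- by move=> t _; rewrite derive1E; have [_] := Ff t.
Qed.

Lemma normr_le_integral_derive F f M :
  (forall t : R, is_derive t 1 F (f t)) -> continuous f ->
  (forall t, M < `|t| -> F t = 0) ->
  forall x, (`|F x|%:E <= \int[mu1]_t `|f t|%:E)%E.
Proof.
move=> Ff cf F0 x; pose a : R := - (`|M| + `|x| + 1).
have ax : a < x.
  by rewrite /a; have := ler_norm (- x); have := normr_ge0 M; rewrite normrN; lra.
have Fa : F a = 0.
  apply: F0; rewrite /a normrN ger0_norm ?addr_ge0//.
  by have := ler_norm M; have := normr_ge0 x; lra.
have mf : measurable_fun setT f by exact: continuous_measurable_fun.
have := integral_itv_is_derive ax Ff cf; rewrite Fa subr0 => FE.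
rewrite -abse_EFin -FE; apply: le_trans (le_abse_integral _ _ _) _ => //.
  by apply/measurable_EFinP; exact: measurable_funTS.
apply: ge0_subset_integral => //.
apply/measurable_EFinP; exact: measurableT_comp.
Qed.

Lemma integral_derive_eq0 F f M :
  (forall t : R, is_derive t 1 F (f t)) -> continuous f ->
  (forall t, M < `|t| -> F t = 0) -> (forall t, M < `|t| -> f t = 0) ->
  (\int[mu1]_t (f t)%:E = 0)%E.
Proof.
move=> Ff cf F0 f0; pose a : R := `|M| + 1.
have a0 : 0 < a by rewrite /a ltr_pwDr.
have Ma : M < a by rewrite /a; have := ler_norm M; lra.
have Fa (e : R) : `|e| = a -> F e = 0 by move=> ea; apply: F0; rewrite ea.
transitivity (\int[mu1]_(t in `[(- a)%R, a]) (f t)%:E)%E.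
  rewrite [RHS]integral_mkcond; apply: eq_integral => t _.
  rewrite patchE; case: ifPn => //; rewrite notin_setE/= in_itv/= => /negP ta.
  by rewrite f0// (lt_le_trans Ma)// leNgt ltr_norml; apply: contra ta => /andP[? ?]; rewrite !ltW.
rewrite (integral_itv_is_derive _ Ff cf) ?Fa ?subrr//; last by rewrite gtrN.
- by rewrite normrN gtr0_norm.
- by rewrite gtr0_norm.
Qed.

End line.

Section plane_calculus.
Context {R : realType}.
Local Notation plane := (measurableTypeR R * measurableTypeR R)%type.
Local Notation mu1 := (@lebesgue_measure R).
Implicit Types (u v : R * R -> R) (M : R).

(** Partial derivatives are recorded along lines rather than as directional
    derivatives, since the fundamental theorem of calculus and the chain rule
    are used one variable at a time. *)
Definition C1_plane u u1 u2 :=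
  [/\ continuous u1, continuous u2, continuous u,
      forall x y : R, is_derive x 1 (fun t => u (t, y)) (u1 (x, y)) &
      forall x y : R, is_derive y 1 (fun t => u (x, t)) (u2 (x, y))].

(** Compact support, in a form that is stable by products and that restricts
    to lines. *)
Definition vanish_off M u :=
  forall x, (M < `|x.1|) || (M < `|x.2|) -> u x = 0.

Lemma continuous_fst_line (u : R * R -> R) y : continuous u ->
  continuous (fun t => u (t, y)).
Proof.
move=> cu t; apply: (@continuous_comp _ _ _ (fun t => (t, y)) u); last exact: cu.
apply: (@cvg_pair _ _ _ (nbhs t) (nbhs t) (nbhs y) _ _ _ id (cst y)).
  exact: cvg_id.
exact: cvg_cst.
Qed.

Lemma continuous_snd_line (u : R * R -> R) x : continuous u ->
  continuous (fun t => u (x, t)).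
Proof.
move=> cu t; apply: (@continuous_comp _ _ _ (fun t => (x, t)) u); last exact: cu.
apply: (@cvg_pair _ _ _ (nbhs t) (nbhs x) (nbhs t) _ _ _ (cst x) id).
  exact: cvg_cst.
exact: cvg_id.
Qed.

Lemma continuous_vanish_integrable M u : continuous u -> vanish_off M u ->
  (@leb2 R).-integrable setT (EFin \o u).
Proof.
move=> cu u0.
pose K : set plane := `[- M, M] `*` `[- M, M].
have mK : measurable K by apply: measurableX; exact: measurable_itv.
have uK : EFin \o u = (EFin \o u) \_ K.
  apply/funext => -[x y]; rewrite patchE; case: ifPn => //.
  rewrite notin_setE /K/= => xyK; congr EFin; apply: u0 => /=.
  rewrite !ltNge -negb_and; apply/negP => /andP[xM yM].
  by apply: xyK; split; rewrite in_itv/= -ler_norml.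
rewrite uK; apply/(integrable_mkcond _ mK).
have cK : compact (K : set (R * R)).
  by apply: compact_setX; exact: segment_compact.
apply: measurable_bounded_integrable => //.
- have lM : mu1 `[- M, M] \is a fin_num.
    by rewrite lebesgue_measure_itv/=; case: ifPn => //; rewrite -EFinB.
  rewrite [X in (X < _)%E](product_measure1E mu1 mu1 (measurable_itv _) (measurable_itv _)).
  by rewrite ltey_eq fin_numM.
- by apply: measurable_funTS; exact: continuous_measurable_plane.
- have : compact (u @` K) by apply: continuous_compact => //; exact: continuous_subspaceT.
  move=> /compact_bounded; rewrite /bounded_set /bounded_near.
  apply: filterS => N uN x Kx; apply: uN; by exists x.
Qed.

(** The divergence theorem without boundary term, one component at a time. *)
Lemma integral_C1_plane_eq0 M u u1 u2 : C1_plane u u1 u2 ->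
  vanish_off M u -> vanish_off M u1 -> vanish_off M u2 ->
  (\int[@leb2 R]_z (u1 z)%:E = 0 /\ \int[@leb2 R]_z (u2 z)%:E = 0)%E.
Proof.
move=> [c1 c2 cu d1 d2] u0 u10 u20; split.
- rewrite -(integral21_prod_meas1 (continuous_vanish_integrable c1 u10)).
  suff u1y (y : R) : (\int[mu1]_t (u1 (t, y))%:E = 0)%E.
    by apply: integral0_eq => y _; exact: u1y.
  apply: (integral_derive_eq0 (F := fun t => u (t, y)) (f := fun t => u1 (t, y)) (M := M)).
  + exact: continuous_fst_line.
  + by move=> t Mt; apply: u0; rewrite Mt.
  + by move=> t Mt; apply: u10; rewrite Mt.
- rewrite -(integral12_prod_meas1 (continuous_vanish_integrable c2 u20)).
  suff u2x (x : R) : (\int[mu1]_t (u2 (x, t))%:E = 0)%E.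
    by apply: integral0_eq => x _; exact: u2x.
  apply: (integral_derive_eq0 (F := fun t => u (x, t)) (f := fun t => u2 (x, t)) (M := M)).
  + exact: continuous_snd_line.
  + by move=> t Mt; apply: u0; rewrite Mt orbT.
  + by move=> t Mt; apply: u20; rewrite Mt orbT.
Qed.

(** Gagliardo's inequality: [|u (x, y)|] is bounded both by the integral of
    [|u1|] on the horizontal line through [(x, y)], which depends on [y] only,
    and by that of [|u2|] on the vertical line, which depends on [x] only; the
    product of these two bounds integrates to a product. *)
Lemma integral_sqr_le_Gagliardo M u u1 u2 : C1_plane u u1 u2 -> vanish_off M u ->
  (\int[@leb2 R]_z ((u z) ^+ 2)%:E <=
   (\int[@leb2 R]_z `|u1 z|%:E) * (\int[@leb2 R]_z `|u2 z|%:E))%E.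
Proof.
move=> [c1 c2 cu d1 d2] u0.
pose P y := (\int[mu1]_t `|u1 (t, y)|%:E)%E.
pose Q x := (\int[mu1]_t `|u2 (x, t)|%:E)%E.
have mabs v : continuous v -> measurable_fun [set: plane] (fun z => `|v z|%:E).
  move=> cv; apply/measurable_EFinP; apply: measurableT_comp => //.
  exact: continuous_measurable_plane.
have P0 y : (0 <= P y)%E by exact: integral_ge0.
have Q0 x : (0 <= Q x)%E by exact: integral_ge0.
have mP : measurable_fun setT P.
  exact: (measurable_fun_fubini_tonelli_G (m1 := mu1) _ (mabs _ c1)).
have mQ : measurable_fun setT Q.
  exact: (measurable_fun_fubini_tonelli_F (m2 := mu1) _ (mabs _ c2)).
have uP (x y : R) : (`|u (x, y)|%:E <= P y)%E.
  apply: (normr_le_integral_derive (F := fun t => u (t, y)) (f := fun t => u1 (t, y)) (M := M)).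
  + exact: continuous_fst_line.
  + by move=> t Mt; apply: u0; rewrite Mt.
have uQ (x y : R) : (`|u (x, y)|%:E <= Q x)%E.
  apply: (normr_le_integral_derive (F := fun t => u (x, t)) (f := fun t => u2 (x, t)) (M := M)).
  + exact: continuous_snd_line.
  + by move=> t Mt; apply: u0; rewrite Mt orbT.
have -> : (\int[@leb2 R]_z `|u1 z|%:E = \int[mu1]_y P y)%E.
  by rewrite /leb2 fubini_tonelli2//; exact: mabs.
have -> : (\int[@leb2 R]_z `|u2 z|%:E = \int[mu1]_x Q x)%E.
  by rewrite /leb2 fubini_tonelli1//; exact: mabs.
have mu2 : measurable_fun [set: plane] (fun z => ((u z) ^+ 2)%:E).
  by apply/measurable_EFinP/measurable_funX; exact: continuous_measurable_plane.
rewrite /leb2 fubini_tonelli1//=; last by move=> z; rewrite lee_fin sqr_ge0.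
rewrite muleC -ge0_integralZr//; last exact: integral_ge0.
apply: ge0_le_integral => //.
- move=> x _; apply: integral_ge0 => y _; by rewrite lee_fin sqr_ge0.
- by apply: measurable_fun_fubini_tonelli_F => //= z; rewrite lee_fin sqr_ge0.
- by apply: emeasurable_funM => //.
move=> x _; rewrite /fubini_F -ge0_integralZl//.
apply: ge0_le_integral => //.
- by move=> y _; rewrite lee_fin sqr_ge0.
- exact: (measurable_fun_pair2 x mu2).
- by apply: emeasurable_funM.
- by move=> y _; rewrite -real_normK ?num_real// expr2 EFinM lee_pmul.
Qed.

End plane_calculus.
Section C1_closure.
Context {R : realType}.
Implicit Types (u v : R * R -> R) (M : R).

Definition rsq (z : R * R) : R := z.1 ^+ 2 + z.2 ^+ 2.

Lemma rsq_ge0 z : 0 <= rsq z.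
Proof. by rewrite addr_ge0// sqr_ge0. Qed.

Lemma rsq_continuous : continuous rsq.
Proof.
move=> z; rewrite /rsq; apply: cvgD; rewrite /continuous_at;
  under eq_fun do rewrite expr2; rewrite expr2; apply: cvgM;
  by [exact: cvg_fst | exact: cvg_snd].
Qed.

Lemma C1_planeM u u1 u2 v v1 v2 : C1_plane u u1 u2 -> C1_plane v v1 v2 ->
  C1_plane (fun z => u z * v z) (fun z => u1 z * v z + u z * v1 z)
           (fun z => u2 z * v z + u z * v2 z).
Proof.
move=> [cu1 cu2 cu du1 du2] [cv1 cv2 cv dv1 dv2]; split.
- by move=> z; apply: cvgD; apply: cvgM; [exact: cu1|exact: cv|exact: cu|exact: cv1].
- by move=> z; apply: cvgD; apply: cvgM; [exact: cu2|exact: cv|exact: cu|exact: cv2].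
- by move=> z; apply: cvgM; [exact: cu|exact: cv].
- move=> x y; apply: is_derive_eq (is_deriveM (du1 x y) (dv1 x y)) _.
  by rewrite /GRing.scale/= addrC mulrC.
- move=> x y; apply: is_derive_eq (is_deriveM (du2 x y) (dv2 x y)) _.
  by rewrite /GRing.scale/= addrC mulrC.
Qed.

Lemma C1_planeX u u1 u2 k : C1_plane u u1 u2 ->
  C1_plane (fun z => u z ^+ k.+1) (fun z => k.+1%:R * u z ^+ k * u1 z)
           (fun z => k.+1%:R * u z ^+ k * u2 z).
Proof.
move=> [cu1 cu2 cu du1 du2].
have cX n : continuous (fun z => u z ^+ n).
  move=> z; apply: (@continuous_comp _ _ _ u (fun x => x ^+ n)); first exact: cu.
  exact: exprn_continuous.
split=> //.
- move=> z; apply: cvgM; last exact: cu1.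
  by apply: cvgM; [exact: cvg_cst|exact: cX].
- move=> z; apply: cvgM; last exact: cu2.
  by apply: cvgM; [exact: cvg_cst|exact: cX].
- by move=> x y; have := is_deriveX k.+1 (du1 x y); rewrite exprfctE.
- by move=> x y; have := is_deriveX k.+1 (du2 x y); rewrite exprfctE.
Qed.

Lemma C1_plane_radial (g g' : R -> R) :
  (forall s : R, 0 <= s -> is_derive s 1 g (g' s)) ->
  (forall s : R, 0 <= s -> {for s, continuous g'}) ->
  C1_plane (fun z => g (rsq z)) (fun z => 2 * z.1 * g' (rsq z))
           (fun z => 2 * z.2 * g' (rsq z)).
Proof.
move=> dg cg'.
have cg s : 0 <= s -> {for s, continuous g}.
  move=> s0; apply: differentiable_continuous; apply/derivable1_diffP.
  by have [] := dg _ s0.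
have crad (h : R -> R) : (forall s, 0 <= s -> {for s, continuous h}) ->
    continuous (fun z => h (rsq z)).
  move=> ch z; apply: (@continuous_comp _ _ _ rsq h); first exact: rsq_continuous.
  by apply: ch; exact: rsq_ge0.
have dsq (x c : R) : is_derive x 1 (fun t => t ^+ 2 + c) (2 * x).
  have h := is_deriveD (is_deriveX 2 (is_derive_id x 1)) (is_derive_cst c x 1).
  by apply: is_derive_eq h _; rewrite addr0 /GRing.scale/= mulr1 expr1.
split.
- move=> z; apply: cvgM; last exact: crad.
  by apply: cvgM; [exact: cvg_cst|exact: cvg_fst].
- move=> z; apply: cvgM; last exact: crad.
  by apply: cvgM; [exact: cvg_cst|exact: cvg_snd].
- exact: crad.
- move=> x y.
  have h := @is_derive1_comp _ g (fun t => t ^+ 2 + y ^+ 2) x _ _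
    (dg _ (rsq_ge0 (x, y))) (dsq x (y ^+ 2)).
  by apply: is_derive_eq h _; rewrite mulrC.
- move=> x y; have -> : (fun t => g (rsq (x, t))) = g \o (fun t => t ^+ 2 + x ^+ 2).
    by apply/funext => t; rewrite /rsq/= addrC.
  have g0 : 0 <= (fun t => t ^+ 2 + x ^+ 2) y by rewrite addr_ge0// sqr_ge0.
  have h := @is_derive1_comp _ g (fun t => t ^+ 2 + x ^+ 2) y _ _
    (dg _ g0) (dsq y (x ^+ 2)).
  by apply: is_derive_eq h _; rewrite mulrC /= /rsq/= [in RHS]addrC.
Qed.

Lemma vanish_offMl M u v : vanish_off M u -> vanish_off M (fun z => u z * v z).
Proof. by move=> u0 z /u0 ->; rewrite mul0r. Qed.

End C1_closure.

(** * Test functions *)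

Section test_functions.
Context {R : realType}.
Implicit Types (phi : R * R -> R).

Lemma is_derive_line1 phi x y : derivable phi (x, y) e1 ->
  is_derive x 1 (fun t => phi (t, y)) ('D_e1 phi (x, y)).
Proof.
have E : (fun h : R => h^-1 *: ((phi \o shift (x, y)) (h *: e1) - phi (x, y))) =
         (fun h : R => h^-1 *: (((fun t => phi (t, y)) \o shift x) (h *: 1)
           - phi (x, y))).
  by apply/funext => h /=; congr (_ *: (phi (_, _) - _)); rewrite /e1/= scaler0 add0r.
by rewrite /derivable /derive E => d; split.
Qed.

Lemma is_derive_line2 phi x y : derivable phi (x, y) e2 ->
  is_derive y 1 (fun t => phi (x, t)) ('D_e2 phi (x, y)).
Proof.
have E : (fun h : R => h^-1 *: ((phi \o shift (x, y)) (h *: e2) - phi (x, y))) =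
         (fun h : R => h^-1 *: (((fun t => phi (x, t)) \o shift y) (h *: 1)
           - phi (x, y))).
  by apply/funext => h /=; congr (_ *: (phi (_, _) - _)); rewrite /e2/= scaler0 add0r.
by rewrite /derivable /derive E => d; split.
Qed.

Lemma test_fun_C1 phi : test_fun phi ->
  C1_plane phi ('D_e1 phi) ('D_e2 phi).
Proof.
move=> [sphi _ _].
have [cphi d1 d2] := sphi [::].
have [c1 _ _] := sphi [:: true]; have [c2 _ _] := sphi [:: false].
split; [exact: c1|exact: c2|exact: cphi| |].
- by move=> x y; apply: is_derive_line1; exact: d1.
- by move=> x y; apply: is_derive_line2; exact: d2.
Qed.

Lemma test_fun_vanish_off phi : test_fun phi -> exists M, vanish_off M phi.
Proof.
move=> [_ /compact_bounded [M [_ bM]] _]; exists (M + 1) => x xM.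
apply/eqP/negP => phix.
have xs : closure [set x | phi x != 0] x by apply: subset_closure; exact/negP.
have := bM (M + 1) _ x xs; rewrite ltrDl => /(_ ltr01).
rewrite /= leNgt => /negP; apply; rewrite prod_normE num_lt_max.
exact: xM.
Qed.

Lemma test_fun_disc phi z : test_fun phi -> rsq z <= 1 -> phi z = 0.
Proof.
move=> [_ _ sub] z1; apply/eqP/negP => phiz.
have /sub : closure [set x | phi x != 0] z by apply: subset_closure; exact/negP.
apply; rewrite /disc/= /enorm -[leRHS]sqrtr1; exact: ler_wsqrtr.
Qed.

Lemma extP (z : R * R) : ext z <-> 1 < rsq z.
Proof.
rewrite /ext /disc /setC/= /enorm -{1}[1]sqrtr1; split.
  by move=> z1; rewrite ltNge; apply/negP => /ler_wsqrtr.
by move=> z1; apply/negP; rewrite -ltNge ltr_sqrt// (lt_trans ltr01).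
Qed.

End test_functions.
(** * The weight and the Hardy inequality *)

Section weights.
Context {R : realType}.
Implicit Types (s d : R) (phi : R * R -> R).

Definition lg s : R := 1 + ln (1 + s).

Lemma lg_ge1 s : 0 <= s -> 1 <= lg s.
Proof. by move=> s0; rewrite /lg lerDl ln_ge0// lerDl. Qed.

Lemma lg_gt0 s : 0 <= s -> 0 < lg s.
Proof. by move=> /lg_ge1; exact: lt_le_trans. Qed.

Lemma lg_le s : 0 <= s -> lg s <= 1 + s.
Proof. by move=> s0; rewrite /lg lerD2l le_ln1Dx// (lt_le_trans _ s0). Qed.

Lemma is_derive_lg s : 0 <= s -> is_derive s 1 lg (1 + s)^-1.
Proof.
move=> s0; have s1 : 0 < 1 + s by rewrite ltr_pwDl.
have h1 := is_deriveD (is_derive_cst (1 : R) s (1 : R)) (is_derive_id s (1 : R)).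
have h2 := @is_derive1_comp _ (@ln R) (fun t : R => 1 + t) s _ _ (is_derive1_ln s1) h1.
have h3 := is_deriveD (is_derive_cst (1 : R) s (1 : R)) h2.
by apply: is_derive_eq h3 _; rewrite !add0r mulr1.
Qed.

Lemma is_derive_for_continuous (g : R -> R) s l : is_derive s 1 g l ->
  {for s, continuous g}.
Proof.
by move=> [dg _]; apply: differentiable_continuous; exact/derivable1_diffP.
Qed.

(** The square root of the damped weight; see [rho_sqr]. *)
Definition rho d s : R := Num.sqrt (lg s) * (1 + d * s)^-1.

Definition rho_log_deriv d s : R :=
  (2 * ((1 + s) * lg s))^-1 - d * (1 + d * s)^-1.

Lemma is_derive_rho d s : 0 <= d -> 0 <= s ->
  is_derive s 1 (rho d) (rho d s * rho_log_deriv d s).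
Proof.
move=> d0 s0; have l0 := lg_gt0 s0.
have ds0 : 0 < 1 + d * s by rewrite ltr_pwDl// mulr_ge0.
have s1 : 0 < 1 + s by rewrite ltr_pwDl.
have h1 := @is_derive1_comp _ (@Num.sqrt R) lg s _ _
  (is_derive1_sqrt l0) (is_derive_lg s0).
have h2 : is_derive s 1 (fun t : R => 1 + d * t) d.
  have h := is_deriveD (is_derive_cst (1 : R) s (1 : R))
    (is_deriveM (is_derive_cst (d : R) s (1 : R)) (is_derive_id s (1 : R))).
  by apply: is_derive_eq h _; rewrite /GRing.scale/= add0r mulr1 mulr0 addr0.
have h3 := @is_deriveV _ (fun t : R => 1 + d * t) s _ _ (lt0r_neq0 ds0) h2.
have h4 := is_deriveM h1 h3.
apply: is_derive_eq h4 _.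
rewrite /rho /rho_log_deriv /GRing.scale/=.
have := sqr_sqrtr (ltW l0); have : 0 < Num.sqrt (lg s) by rewrite sqrtr_gt0.
set q := Num.sqrt _ => q0 <-.
by field; rewrite !gt_eqF.
Qed.

Lemma continuous_lg s : 0 <= s -> {for s, continuous lg}.
Proof. by move=> s0; apply: is_derive_for_continuous; exact: is_derive_lg. Qed.

Lemma continuous_lgV s : 0 <= s ->
  {for s, continuous (fun t : R => ((1 + t) * lg t)^-1)}.
Proof.
move=> s0; apply: cvgV.
  by rewrite gt_eqF// mulr_gt0 ?lg_gt0// ltr_pwDl.
apply: cvgM; last exact: continuous_lg.
by apply: cvgD; [exact: cvg_cst|exact: cvg_id].
Qed.

Lemma continuous_rho_log_deriv d s : 0 <= d -> 0 <= s ->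
  {for s, continuous (rho_log_deriv d)}.
Proof.
move=> d0 s0; apply: cvgB.
  rewrite (_ : (fun t => _) = (fun t : R => 2^-1 * ((1 + t) * lg t)^-1)); last first.
    by apply/funext => t; rewrite invfM.
  by rewrite invfM; apply: cvgM; [exact: cvg_cst|exact: continuous_lgV].
apply: cvgM; first exact: cvg_cst.
apply: cvgV; first by rewrite gt_eqF// ltr_pwDl// mulr_ge0.
by apply: cvgD; [exact: cvg_cst|apply: cvgM; [exact: cvg_cst|exact: cvg_id]].
Qed.

Lemma C1_plane_rho d : 0 <= d ->
  C1_plane (fun z => rho d (rsq z))
    (fun z => 2 * z.1 * (rho d (rsq z) * rho_log_deriv d (rsq z)))
    (fun z => 2 * z.2 * (rho d (rsq z) * rho_log_deriv d (rsq z))).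
Proof.
move=> d0; apply: (C1_plane_radial (g := rho d)
    (g' := fun s => rho d s * rho_log_deriv d s)) => s s0.
  exact: is_derive_rho.
apply: cvgM; last exact: continuous_rho_log_deriv.
by apply: is_derive_for_continuous; exact: is_derive_rho.
Qed.

(** The Hardy weight [1 / ((1 + |x|^2) (1 + ln (1 + |x|^2))^2)], up to
    a bounded factor and away from the origin the squared size of the gradient
    of [ln (lg |x|^2)]. *)
Definition kap2 s : R := ((1 + s) * lg s ^+ 2)^-1.

Lemma kap2_ge0 s : 0 <= s -> 0 <= kap2 s.
Proof. by move=> s0; rewrite invr_ge0 mulr_ge0 ?sqr_ge0// addr_ge0. Qed.

Lemma continuous_kap2 : continuous (fun z : R * R => kap2 (rsq z)).
Proof.
move=> z; apply: (@continuous_comp _ _ _ rsq kap2); first exact: rsq_continuous.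
have s0 := rsq_ge0 z; apply: cvgV.
  by rewrite gt_eqF// mulr_gt0 ?exprn_gt0 ?lg_gt0// ltr_pwDl.
apply: cvgM.
  by apply: cvgD; [exact: cvg_cst|exact: cvg_id].
by under eq_fun do rewrite expr2; rewrite expr2; apply: cvgM; exact: continuous_lg.
Qed.

(** The Hardy inequality results from integrating the divergence of [phi^2 V]
    for the vector field [V = hardy_field |x|^2 * x].  The shift by [1/8] makes
    [V] smooth at the origin, while [div V] remains negative, of the order of
    [- kap2], outside the unit disc. *)
Definition hardy_field s : R := ((s + 8^-1) * lg s)^-1.

Definition hardy_field' s : R :=
  - hardy_field s ^+ 2 * (lg s + (s + 8^-1) * (1 + s)^-1).

Lemma is_derive_hardy_field s : 0 <= s ->
  is_derive s 1 hardy_field (hardy_field' s).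
Proof.
move=> s0; have l0 := lg_gt0 s0.
have h1 : is_derive s 1 (fun t : R => t + 8^-1) 1.
  by have := is_deriveD (is_derive_id s (1 : R)) (is_derive_cst (8^-1 : R) s (1 : R)); rewrite addr0.
have h2 := is_deriveM h1 (is_derive_lg s0).
have n0 : ((fun t : R => t + 8^-1) * lg)%R s != 0.
  by rewrite gt_eqF//= mulr_gt0// ltr_wpDl.
have h3 := @is_deriveV _ ((fun t : R => t + 8^-1) * lg)%R s _ _ n0 h2.
apply: is_derive_eq h3 _.
rewrite /hardy_field' /hardy_field /GRing.scale/= mulr1 exprVn.
by rewrite (addrC (lg s)).
Qed.

Lemma C1_plane_hardy_field : C1_plane (fun z => hardy_field (rsq z))
  (fun z => 2 * z.1 * hardy_field' (rsq z)) (fun z => 2 * z.2 * hardy_field' (rsq z)).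
Proof.
apply: C1_plane_radial => s s0; first exact: is_derive_hardy_field.
have ch : {for s, continuous hardy_field}.
  by apply: is_derive_for_continuous; exact: is_derive_hardy_field.
apply: cvgM.
  by apply: cvgN; under eq_fun do rewrite expr2; rewrite expr2; apply: cvgM.
apply: cvgD; first exact: continuous_lg.
apply: cvgM; first by apply: cvgD; [exact: cvg_id|exact: cvg_cst].
apply: cvgV; first by rewrite gt_eqF// ltr_pwDl.
by apply: cvgD; [exact: cvg_cst|exact: cvg_id].
Qed.

Lemma C1_plane_fst : C1_plane (fun z : R * R => z.1) (fun=> 1) (fun=> 0).
Proof.
split.
- by move=> z; exact: cvg_cst.
- by move=> z; exact: cvg_cst.
- by move=> z; exact: cvg_fst.
- by move=> x y; exact: is_derive_id.
- by move=> x y; exact: is_derive_cst.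
Qed.

Lemma C1_plane_snd : C1_plane (fun z : R * R => z.2) (fun=> 0) (fun=> 1).
Proof.
split.
- by move=> z; exact: cvg_cst.
- by move=> z; exact: cvg_cst.
- by move=> z; exact: cvg_snd.
- by move=> x y; exact: is_derive_cst.
- by move=> x y; exact: is_derive_id.
Qed.

(** Bounding [lg s] by [1 + s] reduces the claim to the quadratic inequality
    [5/4 s^2 >= 3/8 s + 33/128], true for [s >= 1]. *)
Lemma hardy_field_div s : 1 <= s ->
  2 * hardy_field s + 2 * s * hardy_field' s <= - (2^-1 * kap2 s).
Proof.
move=> s1; have s0 : 0 <= s by rewrite (le_trans ler01).
have l0 := lg_gt0 s0; have ls := lg_le s0.
rewrite /hardy_field' /hardy_field /kap2; move: (lg s) l0 ls => l l0 ls.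
have a0 : 0 < s + 8^-1 by rewrite ltr_wpDl.
have b0 : 0 < 1 + s by rewrite ltr_pwDl.
rewrite -subr_le0 [leLHS](_ : _ = (4^-1 * ((1 + s) * l) - 2 * s * (s + 8^-1)
  + 2^-1 * (s + 8^-1) ^+ 2) / ((s + 8^-1) ^+ 2 * (1 + s) * l ^+ 2)); last first.
  by field; rewrite !gt_eqF//; lra.
rewrite pmulr_lle0; last by rewrite invr_gt0 !mulr_gt0// exprn_gt0.
have := ler_wpM2l (ltW b0) ls.
have : 0 <= s * (s - 1) by rewrite mulr_ge0// subr_ge0.
nra.
Qed.

Lemma hardy_field_sqr s : 0 <= s -> s * hardy_field s ^+ 2 <= 8 * kap2 s.
Proof.
move=> s0; have l0 := lg_gt0 s0.
rewrite /hardy_field /kap2; move: (lg s) l0 => l l0.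
have a0 : 0 < s + 8^-1 by rewrite ltr_wpDl.
have b0 : 0 < 1 + s by rewrite ltr_pwDl.
rewrite -subr_ge0 [leRHS](_ : _ = (8 * (s + 8^-1) ^+ 2 - s * (1 + s)) /
  ((s + 8^-1) ^+ 2 * (1 + s) * l ^+ 2)); last first.
  by field; rewrite !gt_eqF//; lra.
rewrite divr_ge0 ?mulr_ge0 ?sqr_ge0 ?(ltW b0)//; nra.
Qed.

(** Here [p] stands for [phi z] and [p1], [p2] for its partial derivatives.  The
    bracket is [div (phi^2 V)]; half of the negative term [phi^2 div V] absorbs
    the cross terms, up to a multiple of the squared gradient. *)
Lemma hardy_pointwise (x y p p1 p2 s : R) : 1 <= s -> s = x ^+ 2 + y ^+ 2 ->
  4^-1 * (kap2 s * p ^+ 2) <=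
  - ((2 * p * p1 * (x * hardy_field s) +
        p ^+ 2 * (1 * hardy_field s + x * (2 * x * hardy_field' s))) +
     (2 * p * p2 * (y * hardy_field s) +
        p ^+ 2 * (1 * hardy_field s + y * (2 * y * hardy_field' s)))) +
  32 * (p1 ^+ 2 + p2 ^+ 2).
Proof.
move=> s1 sE; have s0 : 0 <= s by rewrite (le_trans ler01).
have D := ler_wpM2l (sqr_ge0 p) (hardy_field_div s1).
have F := ler_wpM2l (sqr_ge0 p) (hardy_field_sqr s0).
move: (hardy_field s) (hardy_field' s) (kap2 s) D F => h h' k D F.
have sq (q c : R) : 2 * p * q * (c * h) <= (p * h * c) ^+ 2 / 32 + 32 * q ^+ 2.
  (* Summed over both axes the first terms are (p h)^2 s / 32, at most a quarter
     of k * p^2. *)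
  rewrite -subr_ge0 [leRHS](_ : _ = (p * h * c - 32 * q) ^+ 2 / 32); last by field.
  by rewrite divr_ge0// sqr_ge0.
have E : (p * h * x) ^+ 2 / 32 + (p * h * y) ^+ 2 / 32 = p ^+ 2 * (s * h ^+ 2) / 32.
  by rewrite sE; field.
have -> : - (2 * p * p1 * (x * h) + p ^+ 2 * (1 * h + x * (2 * x * h')) +
   (2 * p * p2 * (y * h) + p ^+ 2 * (1 * h + y * (2 * y * h')))) =
   - (2 * p * p1 * (x * h)) + - (2 * p * p2 * (y * h)) - p ^+ 2 * (2 * h + 2 * s * h').
  by rewrite sE; ring.
move: D F E (sq p1 x) (sq p2 y).
rewrite [p ^+ 2 * - _](_ : _ = - (2^-1 * (k * p ^+ 2))); last by ring.
rewrite [p ^+ 2 * (8 * k)](_ : _ = 8 * (k * p ^+ 2)); last by ring.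
move: (p ^+ 2 * (2 * h + _)) (p ^+ 2 * (s * _)) (k * p ^+ 2) => A1 A2 A3.
move: (2 * p * p1 * _) (2 * p * p2 * _) ((p * h * x) ^+ 2) ((p * h * y) ^+ 2).
move: (p1 ^+ 2) (p2 ^+ 2) => *; lra.
Qed.

End weights.
(** * Moment estimates for test functions *)

Section test_function_estimates.
Context {R : realType}.
Local Notation plane := (measurableTypeR R * measurableTypeR R)%type.
Implicit Types (phi : R * R -> R) (a b d t tau E G : R).
Local Notation "'I' f" := (\int[@leb2 R]_z (f z)%:E)%E (at level 10, f at level 9).

Definition gradsq phi z := 'D_e1 phi z ^+ 2 + 'D_e2 phi z ^+ 2.

Lemma gradsq_ge0 phi z : 0 <= gradsq phi z.
Proof. by rewrite addr_ge0// sqr_ge0. Qed.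

Lemma test_fun_measurable phi : test_fun phi ->
  [/\ measurable_fun [set: plane] phi, measurable_fun [set: plane] ('D_e1 phi),
      measurable_fun [set: plane] ('D_e2 phi) &
      measurable_fun [set: plane] (gradsq phi)].
Proof.
move=> /test_fun_C1[c1 c2 c _ _].
have m1 := continuous_measurable_plane c1.
have m2 := continuous_measurable_plane c2.
split; [exact: continuous_measurable_plane|exact: m1|exact: m2|].
by apply: measurable_funD; apply: measurable_funX; [exact: m1|exact: m2].
Qed.

(** The critical Hardy inequality in the exterior of the disc: integrate
    [hardy_pointwise], the divergence having integral zero.  In the disc, where
    [hardy_pointwise] can fail, [phi] vanishes. *)
Lemma hardy_inequality phi G : test_fun phi ->
  (I (gradsq phi) <= G%:E)%E ->
  (I (fun z => (kap2 (rsq z) * phi z ^+ 2)%R) <= (128 * G)%:E)%E.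
Proof.
move=> tphi IG; have [M phi0] := test_fun_vanish_off tphi.
have Cphi := test_fun_C1 tphi.
have [_ _ cphi _ _] := Cphi.
have [_ _ _ mg] := test_fun_measurable tphi.
have CU := C1_planeM (C1_planeX 1 Cphi) (C1_planeM C1_plane_fst C1_plane_hardy_field).
have CV := C1_planeM (C1_planeX 1 Cphi) (C1_planeM C1_plane_snd C1_plane_hardy_field).
have IU : (I (fun z => 2 * phi z ^+ 1 * 'D_e1 phi z * (z.1 * hardy_field (rsq z)) +
    phi z ^+ 2 * (1 * hardy_field (rsq z) +
      z.1 * (2 * z.1 * hardy_field' (rsq z)))) = 0)%E.
  by apply: (integral_C1_plane_eq0 (M := M) CU _ _ _).1 => z /phi0 z0;
    rewrite z0 ?expr1 ?expr0n/= ?(mulr0, mul0r, addr0).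
have IV : (I (fun z => 2 * phi z ^+ 1 * 'D_e2 phi z * (z.2 * hardy_field (rsq z)) +
    phi z ^+ 2 * (1 * hardy_field (rsq z) +
      z.2 * (2 * z.2 * hardy_field' (rsq z)))) = 0)%E.
  by apply: (integral_C1_plane_eq0 (M := M) CV _ _ _).2 => z /phi0 z0;
    rewrite z0 ?expr1 ?expr0n/= ?(mulr0, mul0r, addr0).
move: CU CV IU IV => [cU _ _ _ _] [_ cV _ _ _].
set U := (fun z => 2 * phi z ^+ 1 * 'D_e1 phi z * (z.1 * _) + _) in cU *.
set V := (fun z => 2 * phi z ^+ 1 * 'D_e2 phi z * (z.2 * _) + _) in cV *.
move=> IU IV.
have iU : (@leb2 R).-integrable setT (EFin \o U).
  apply: (continuous_vanish_integrable (M := M)) => // z /phi0 z0.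
  by rewrite /U z0 expr1 expr0n/= ?(mulr0, mul0r, addr0).
have iV : (@leb2 R).-integrable setT (EFin \o V).
  apply: (continuous_vanish_integrable (M := M)) => // z /phi0 z0.
  by rewrite /V z0 expr1 expr0n/= ?(mulr0, mul0r, addr0).
have iG : (@leb2 R).-integrable setT (EFin \o gradsq phi).
  apply/integrableP; split; first exact/measurable_EFinP.
  under eq_integral do rewrite /= ger0_norm ?gradsq_ge0//.
  exact: le_lt_trans IG (ltry _).
have mK : measurable_fun [set: plane] (fun z => kap2 (rsq z) * phi z ^+ 2).
  apply: continuous_measurable_plane => z; apply: cvgM; first exact: continuous_kap2.
  by under eq_fun do rewrite expr2; rewrite expr2; apply: cvgM; exact: cphi.
have K0 z : 0 <= kap2 (rsq z) * phi z ^+ 2.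
  by rewrite mulr_ge0 ?sqr_ge0 ?kap2_ge0 ?rsq_ge0.
have iUV := integrableD measurableT iU iV.
have iN := integrableN iUV.
have iGZ := integrableZl measurableT 32 iG.
have -> : (I (fun z => (kap2 (rsq z) * phi z ^+ 2)%R) =
    4%:E * \int[@leb2 R]_z (4^-1 * (kap2 (rsq z) * phi z ^+ 2))%:E)%E.
  under [in RHS]eq_integral do rewrite EFinM.
  rewrite ge0_integralZl//; last 2 first.
  - exact/measurable_EFinP.
  - by move=> z _; rewrite lee_fin.
  by rewrite muleA -EFinM mulfV// mul1e.
rewrite (_ : 128 * G = 4 * (32 * G)); last by ring.
rewrite EFinM lee_pmul2l ?ltr0n//.
apply: (@le_trans _ _ (\int[@leb2 R]_z
    (- (EFin (U z) + EFin (V z)) + 32%:E * (gradsq phi z)%:E))%E).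
  apply: ge0_le_integral => //.
  - by move=> z _; rewrite lee_fin mulr_ge0.
  - by apply/measurable_EFinP; apply: measurable_funM.
  - by apply: emeasurable_funD; [exact: measurable_int iN|exact: measurable_int iGZ].
  move=> z _; rewrite -EFinD lee_fin.
  have [z1|z1] := leP 1 (rsq z).
    have := @hardy_pointwise _ z.1 z.2 (phi z) ('D_e1 phi z) ('D_e2 phi z) _ z1 erefl.
    by rewrite /U /V !expr1.
  rewrite /U /V (test_fun_disc tphi (ltW z1)) expr1 expr0n/=.
  rewrite !(mulr0, mul0r, addr0) oppr0 add0r mulr_ge0//.
  exact: gradsq_ge0.
rewrite integralD//.
rewrite (_ : \int[_]_z - _ = 0)%E; last first.
  under eq_integral do rewrite -mulN1e.
  by rewrite (integralZl _ iUV)// integralD// IU IV adde0 mule0.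
rewrite add0e integralZl// EFinM; apply: lee_pmul => //.
by apply: integral_ge0 => z _; rewrite lee_fin gradsq_ge0.
Qed.

(** With [c] a coordinate of the point, [2 * c * rho_log_deriv d s] is the
    logarithmic partial derivative of [rho]: the weight contributes [kap2] and
    the damping contributes [d]. *)
Lemma rho_log_deriv_bound d s c : 0 <= d -> c ^+ 2 <= s ->
  (2 * c * rho_log_deriv d s) ^+ 2 <= 2 * (kap2 s + d).
Proof.
move=> d0 cs; have s0 : 0 <= s by rewrite (le_trans _ cs)// sqr_ge0.
have l0 := lg_gt0 s0.
have b0 : 0 < 1 + s by rewrite ltr_pwDl.
have ds0 : 0 < 1 + d * s by rewrite ltr_pwDl// mulr_ge0.
have A : (c / ((1 + s) * lg s)) ^+ 2 <= kap2 s.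
  rewrite /kap2; move: (lg s) l0 => l l0.
  rewrite -subr_ge0 [leRHS](_ : _ = (1 + s - c ^+ 2) / ((1 + s) ^+ 2 * l ^+ 2)).
    by rewrite divr_ge0 ?mulr_ge0 ?sqr_ge0//; lra.
  by field; rewrite !gt_eqF.
have B : (2 * c * d / (1 + d * s)) ^+ 2 <= d.
  rewrite -subr_ge0 [leRHS](_ : _ =
    d * ((1 - d * s) ^+ 2 + 4 * d * (s - c ^+ 2)) / (1 + d * s) ^+ 2).
    by rewrite divr_ge0 ?sqr_ge0// mulr_ge0// addr_ge0 ?sqr_ge0// !mulr_ge0// subr_ge0.
  by field; rewrite !gt_eqF.
rewrite /rho_log_deriv [2 * c * _](_ : _ =
  c / ((1 + s) * lg s) - 2 * c * d / (1 + d * s)); last first.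
  by field; rewrite !gt_eqF.
move: A B; move: (c / _) (2 * c * d / _) => a b A B.
have := sqr_ge0 (a + b); nra.
Qed.

Lemma vanish_offX M phi k : vanish_off M phi -> vanish_off M (fun z => phi z ^+ k.+1).
Proof. by move=> phi0 z /phi0 ->; rewrite expr0n. Qed.

Lemma rho_continuous d : 0 <= d -> continuous (fun z => rho d (rsq z)).
Proof. by move=> /C1_plane_rho[]. Qed.

(** [512 = 4 * 128], where [128] is the Hardy constant. *)
Definition sobolev_const (k : nat) : R := 2 * k.+1%:R ^+ 2 + 512.

Lemma sobolev_const_gt0 k : 0 < sobolev_const k.
Proof.
apply: ltr_wpDl; last by rewrite ltr0n.
by apply: mulr_ge0; [exact: ler0n|exact: sqr_ge0].
Qed.

(** The cofactor of [phi^k * rho] in a partial derivative of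
    [phi^(k+1) * rho], treated for both axes at once: [p] is the partial
    derivative of [phi] and [c] the corresponding coordinate. *)
Lemma integral_cofactor phi (p c : R * R -> R) (k : nat) d G N :
  test_fun phi -> 0 <= d ->
  (forall z, p z ^+ 2 <= gradsq phi z) -> (forall z, c z ^+ 2 <= rsq z) ->
  measurable_fun [set: plane] (fun z => k.+1%:R * p z + 2 * c z * rho_log_deriv d (rsq z) * phi z) ->
  (I (gradsq phi) <= G%:E)%E -> (I (fun z => (phi z ^+ 2)%R) <= N%:E)%E ->
  (I (fun z => ((k.+1%:R * p z + 2 * c z * rho_log_deriv d (rsq z) * phi z) ^+ 2)%R) <=
   (sobolev_const k * (G + d * N))%:E)%E.
Proof.
move=> tphi d0 pg cr mb IG IN.
have IH := hardy_inequality tphi IG.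
have [mphi _ _ mg] := test_fun_measurable tphi.
have mK : measurable_fun [set: plane] (fun z => kap2 (rsq z)).
  by apply: continuous_measurable_plane; exact: continuous_kap2.
have mphi2 : measurable_fun [set: plane] (fun z => phi z ^+ 2) by exact: measurable_funX.
have mKphi : measurable_fun [set: plane] (fun z => kap2 (rsq z) * phi z ^+ 2).
  exact: measurable_funM.
have K0 z : 0 <= kap2 (rsq z) by exact/kap2_ge0/rsq_ge0.
have G0 : 0 <= G.
  by rewrite -lee_fin; apply: le_trans IG; apply: integral_ge0 => z _; rewrite lee_fin gradsq_ge0.
have N0 : 0 <= N.
  by rewrite -lee_fin; apply: le_trans IN; apply: integral_ge0 => z _; rewrite lee_fin sqr_ge0.
have P0 z : 0 <= kap2 (rsq z) * phi z ^+ 2 by rewrite mulr_ge0 ?sqr_ge0 ?K0.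
pose a := 2 * k.+1%:R ^+ 2 : R.
have a0 : 0 <= a by rewrite mulr_ge0// sqr_ge0.
have IaK := ge0_integral_lin2_le a0 (ler0n R 4) mg mKphi (gradsq_ge0 phi) P0 IG IH.
have d40 : 0 <= 4 * d by rewrite mulr_ge0.
have maK : measurable_fun [set: plane]
    (fun z => a * gradsq phi z + 4 * (kap2 (rsq z) * phi z ^+ 2)).
  by apply: measurable_funD; exact: measurable_funM.
have aK0 z : 0 <= a * gradsq phi z + 4 * (kap2 (rsq z) * phi z ^+ 2).
  by rewrite addr_ge0// mulr_ge0// gradsq_ge0.
have Iall := ge0_integral_lin2_le ler01 d40 maK mphi2 aK0
  (fun z => sqr_ge0 (phi z)) IaK IN.
apply: le_trans (le_trans _ Iall) _; last first.
  rewrite lee_fin /sobolev_const -/a -[4 * d * N]mulrA.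
  have := mulr_ge0 d0 N0; move: (d * N) => dN dN0.
  have := mulr_ge0 a0 dN0; lra.
apply: ge0_le_integral => //.
- by move=> z _; rewrite lee_fin sqr_ge0.
- by apply/measurable_EFinP; exact: measurable_funX.
- apply/measurable_EFinP; apply: measurable_funD; exact: measurable_funM.
move=> z _; rewrite lee_fin.
have := rho_log_deriv_bound d0 (cr z).
move=> /(ler_wpM2r (sqr_ge0 (phi z))).
have := ler_wpM2l a0 (pg z); rewrite /a.
move: (gradsq phi z) (2 * c z * _) => g r.
have := sqr_ge0 (k.+1%:R * p z - r * phi z).
move: (p z) (phi z) (kap2 _) (k.+1%:R) => p' f K n.
nra.
Qed.

(** One step of the recursion: Gagliardo's inequality, then Cauchy-Schwarz on
    each of the two factors. *)
Lemma integral_exp_step phi (k : nat) d G N al : test_fun phi -> 0 <= d ->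
  (I (gradsq phi) <= G%:E)%E -> (I (fun z => (phi z ^+ 2)%R) <= N%:E)%E ->
  0 <= al -> (I (fun z => ((phi z ^+ k * rho d (rsq z)) ^+ 2)%R) <= al%:E)%E ->
  (I (fun z => ((phi z ^+ k.+1 * rho d (rsq z)) ^+ 2)%R) <=
    (al * (sobolev_const k * (G + d * N)))%:E)%E.
Proof.
move=> tphi d0 IG IN al0 Ial.
have [M phi0] := test_fun_vanish_off tphi.
have Cphi := test_fun_C1 tphi.
have [mphi m1 m2 _] := test_fun_measurable tphi.
have G0 : 0 <= G.
  by rewrite -lee_fin; apply: le_trans IG; apply: integral_ge0 => z _; rewrite lee_fin gradsq_ge0.
have N0 : 0 <= N.
  by rewrite -lee_fin; apply: le_trans IN; apply: integral_ge0 => z _; rewrite lee_fin sqr_ge0.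
have Crho := C1_plane_rho d0; have [_ _ crho _ _] := Crho.
have CU := C1_planeM (C1_planeX k Cphi) Crho.
have U0 : vanish_off M (fun z => phi z ^+ k.+1 * rho d (rsq z)).
  exact/vanish_offMl/vanish_offX.
apply: le_trans (integral_sqr_le_Gagliardo CU U0) _.
pose be := sobolev_const k * (G + d * N).
have be0 : 0 <= be.
  by rewrite (mulr_ge0 (ltW (sobolev_const_gt0 k)))// addr_ge0// mulr_ge0.
have mrho : measurable_fun [set: plane] (fun z => rho d (rsq z)).
  exact: continuous_measurable_plane.
have ma : measurable_fun [set: plane] (fun z => phi z ^+ k * rho d (rsq z)).
  by apply: measurable_funM => //; exact: measurable_funX.
have cld : continuous (fun z => rho_log_deriv d (rsq z)).
  move=> z; apply: (@continuous_comp _ _ _ rsq (rho_log_deriv d)).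
    exact: rsq_continuous.
  exact/continuous_rho_log_deriv/rsq_ge0.
have mb (p c : R * R -> R) : measurable_fun [set: plane] p -> measurable_fun [set: plane] c ->
  measurable_fun [set: plane]
    (fun z => k.+1%:R * p z + 2 * c z * rho_log_deriv d (rsq z) * phi z).
  move=> mp mc; apply: measurable_funD; first exact: measurable_funM.
  apply: measurable_funM => //; apply: measurable_funM.
    exact: measurable_funM.
  exact: continuous_measurable_plane.
have factor (p c : R * R -> R) (U' := fun z => k.+1%:R * phi z ^+ k * p z * rho d (rsq z) +
      phi z ^+ k.+1 * (2 * c z * (rho d (rsq z) * rho_log_deriv d (rsq z)))) :
    measurable_fun [set: plane] p -> measurable_fun [set: plane] c ->
    (forall z, p z ^+ 2 <= gradsq phi z) -> (forall z, c z ^+ 2 <= rsq z) ->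
    (\int[@leb2 R]_z `|U' z|%:E <= (Num.sqrt (al * be))%:E)%E.
  move=> mp mc pg cr.
  have := integral_CauchySchwarz ma (mb p c mp mc) al0 be0 Ial
    (integral_cofactor tphi d0 pg cr (mb p c mp mc) IG IN).
  rewrite [X in (X <= _)%E -> _](_ : _ = \int[@leb2 R]_z `|U' z|%:E)%E//.
  by apply: eq_integral => z _; congr (`| _ |%:E); rewrite /U' exprS; ring.
apply: (@le_trans _ _ ((Num.sqrt (al * be))%:E * (Num.sqrt (al * be))%:E)%E).
  apply: lee_pmul; try exact: integral_ge0.
    apply: (factor ('D_e1 phi) fst) => // z.
    - by rewrite lerDl sqr_ge0.
    - by rewrite lerDl sqr_ge0.
  apply: (factor ('D_e2 phi) snd) => // z.
  - by rewrite lerDr sqr_ge0.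
  - by rewrite lerDr sqr_ge0.
by rewrite -EFinM -expr2 sqr_sqrtr// mulr_ge0.
Qed.

Fixpoint moment_const (k : nat) : R :=
  if k is k'.+1 then moment_const k' * sobolev_const k else 80.

Lemma moment_const_gt0 k : 0 < moment_const k.
Proof.
by elim: k => [|k IH]/=; rewrite ?ltr0n// mulr_gt0// sobolev_const_gt0.
Qed.

(** The moment of order two is bounded first, by interpolation between the
    orders one and four: the moment of order four is at most a multiple of the
    one of order two, which can be absorbed because it is finite. *)
Lemma test_fun_moment phi (k : nat) d tau G N b : test_fun phi -> 0 <= d -> 0 < tau ->
  (I (gradsq phi) <= G%:E)%E -> (I (fun z => (phi z ^+ 2)%R) <= N%:E)%E ->
  G + d * N <= tau ^+ 2 ->
  (\int[@leb2 R]_z (`|phi z| * rho d (rsq z) ^+ 2)%:E <= b%:E)%E ->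
  (I (fun z => ((phi z ^+ k.+1 * rho d (rsq z)) ^+ 2)%R) <=
    (moment_const k * tau ^+ k.*2.+1 * b)%:E)%E.
Proof.
move=> tphi d0 tau0 IG IN GN Ib.
have [M phi0] := test_fun_vanish_off tphi.
have Cphi := test_fun_C1 tphi.
have [mphi _ _ _] := test_fun_measurable tphi.
have b0 : 0 <= b.
  rewrite -lee_fin; apply: le_trans Ib; apply: integral_ge0 => z _.
  by rewrite lee_fin mulr_ge0 ?sqr_ge0.
have Crho := C1_plane_rho d0; have [_ _ crho _ _] := Crho.
have mrho : measurable_fun [set: plane] (fun z => rho d (rsq z)).
  exact: continuous_measurable_plane.
have mu n : measurable_fun [set: plane] (fun z => (phi z ^+ n * rho d (rsq z)) ^+ 2).
  by apply: measurable_funX; apply: measurable_funM => //; exact: measurable_funX.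
elim: k => [|k IH].
  set A1 := (\int[_]_z _)%E.
  have A1fin : A1 \is a fin_num.
    apply: integrable_fin_num => //.
    apply: (continuous_vanish_integrable (M := M) (u := fun z => (phi z ^+ 1 * rho d (rsq z)) ^+ 2)).
      have [_ _ + _ _] := C1_planeX 1 (C1_planeM (C1_planeX 0 Cphi) Crho).
      exact.
    by move=> z /phi0 z0; rewrite z0 expr0n/= mul0r expr0n.
  have A10 : 0 <= fine A1.
    by apply/fine_ge0/integral_ge0 => z _; rewrite lee_fin sqr_ge0.
  have A1E : A1 = (fine A1)%:E by rewrite fineK.
  have := @integral_exp_step phi 1 d G N (fine A1) tphi d0 IG IN A10.
  rewrite -A1E => /(_ (lexx _)) A2.
  (* 40^2 is at least twice the constant 520 of the step from order 2 to 4. *)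
  pose t := 40 * tau; have t0 : 0 < t by rewrite mulr_gt0.
  have : (A1 <= (t * b + t ^- 2 * (fine A1 * (sobolev_const 1 * (G + d * N))))%:E)%E.
    have mB : measurable_fun [set: plane] (fun z => `|phi z| * rho d (rsq z) ^+ 2).
      by apply: measurable_funM; [exact: measurableT_comp|exact: measurable_funX].
    have t20 : 0 <= t ^- 2 by rewrite invr_ge0 sqr_ge0.
    have := ge0_integral_lin2_le (ltW t0) t20 mB (mu 2)
      (fun z => mulr_ge0 (normr_ge0 _) (sqr_ge0 _)) (fun z => sqr_ge0 _) Ib A2.
    apply: le_trans; apply: ge0_le_integral => //.
    - by move=> z _; rewrite lee_fin sqr_ge0.
    - exact/measurable_EFinP.
    - by apply/measurable_EFinP; apply: measurable_funD; apply: measurable_funM.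
    move=> z _; rewrite lee_fin expr1; move: (rho d _) => r.
    rewrite [(phi z * r) ^+ 2]exprMn [(phi z ^+ 2 * r) ^+ 2]exprMn.
    rewrite [t * _]mulrA [t ^- 2 * _]mulrA -mulrDl ler_wpM2r ?sqr_ge0//.
    rewrite -[phi z ^+ 2]real_normK ?num_real//.
    have := normr_ge0 (phi z); move: (`|phi z|) => f f0.
    have [ft|tf] := leP f t.
      by rewrite expr2 (le_trans (ler_wpM2r f0 ft))// lerDl mulr_ge0 ?sqr_ge0.
    rewrite (@le_trans _ _ (t ^- 2 * (f ^+ 2) ^+ 2))//.
      rewrite [leRHS]mulrC ler_pdivlMr ?exprn_gt0// [in leRHS]expr2.
      by rewrite ler_wpM2l ?sqr_ge0// ler_sqr ?nnegrE ?ltW// (lt_trans t0).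
    by rewrite lerDr mulr_ge0// ltW.
  rewrite A1E !lee_fin; move: (fine A1) A10 => A A0 h.
  have h2 : t ^- 2 * (A * (sobolev_const 1 * (G + d * N))) <= 2^-1 * A.
    rewrite mulrC ler_pdivrMr ?exprn_gt0//.
    rewrite [leRHS](_ : _ = A * (800 * tau ^+ 2)); last by rewrite /t; field.
    rewrite ler_wpM2l//; have := ler_wpM2l (ltW (sobolev_const_gt0 1)) GN.
    rewrite (_ : sobolev_const 1 = 520); last by rewrite /sobolev_const; ring.
    have := sqr_ge0 tau; move: (G + d * N) (tau ^+ 2) => X Y; lra.
  move: h h2; move: (t ^- 2 * _) => W; rewrite /= expr1 /t; lra.
have al0 : 0 <= moment_const k * tau ^+ k.*2.+1 * b.
  by rewrite mulr_ge0// mulr_ge0 ?(ltW (moment_const_gt0 k))// exprn_ge0// ltW.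
apply: le_trans (integral_exp_step tphi d0 IG IN al0 IH) _.
rewrite lee_fin /= doubleS [tau ^+ k.*2.+3](_ : _ = tau ^+ k.*2.+1 * tau ^+ 2); last first.
  by rewrite -exprD addn2.
rewrite [leRHS](_ : _ = moment_const k * tau ^+ k.*2.+1 * b *
  (sobolev_const k.+1 * tau ^+ 2)); last by ring.
by rewrite ler_wpM2l// ler_wpM2l// ltW// sobolev_const_gt0.
Qed.

End test_function_estimates.
(** * The measures of the exterior domain *)

Section exterior_measures.
Context {R : realType}.
Local Notation plane := (measurableTypeR R * measurableTypeR R)%type.
Implicit Types (phi f : R * R -> R) (b d s t tau G N K : R).

Lemma enorm_rsq (z : R * R) : enorm z = Num.sqrt (rsq z).
Proof. by []. Qed.

Lemma measurable_log_weight :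
  measurable_fun (ext : set plane) (fun z => 1 + ln (enorm z)).
Proof.
apply: measurable_funTS; apply: measurable_funD => //.
by apply: measurableT_comp => //; exact: measurable_enorm.
Qed.

Lemma log_weight_ge1 (z : R * R) : ext z -> 1 <= 1 + ln (enorm z).
Proof. by move=> /negP; rewrite -ltNge => z1; rewrite lerDl ln_ge0// ltW. Qed.

Lemma mul_log_weight_ge0 (a : R) (z : R * R) : 0 <= a -> ext z ->
  (0 <= a%:E * (1 + ln (enorm z))%:E)%E.
Proof.
move=> a0 /log_weight_ge1 w1; rewrite -EFinM lee_fin.
by apply: mulr_ge0; [exact: a0|exact: le_trans ler01 w1].
Qed.

Lemma log_weight_bounds (z : R * R) : ext z ->
  1 + ln (enorm z) <= lg (rsq z) <= 2 * (1 + ln (enorm z)).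
Proof.
move=> /extP z1; have z0 : 0 < rsq z by rewrite (lt_trans ltr01).
rewrite enorm_rsq -(powR12_sqrt (ltW z0)) ln_powR /lg.
have l1 : ln (rsq z) <= ln (1 + rsq z) by rewrite ler_ln ?posrE ?lerDr// ltr_pwDl// ltW.
have l2 : ln (1 + rsq z) <= ln (rsq z) + 1.
  rewrite (_ : 1 + rsq z = rsq z * (1 + (rsq z)^-1)); last by field; rewrite gt_eqF.
  have i0 : 0 < (rsq z)^-1 by rewrite invr_gt0.
  rewrite lnM ?posrE//; last by rewrite addr_gt0.
  rewrite lerD2l (le_trans (le_ln1Dx _))//; last by rewrite invf_le1// ltW.
  by rewrite (lt_trans _ i0).
have l0 : 0 <= ln (rsq z) by rewrite ln_ge0// ltW.
by apply/andP; split; lra.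
Qed.

Lemma integral_leb_ext (F : plane -> \bar R) : measurable_fun setT F ->
  (forall z, 0 <= F z)%E ->
  (\int[@leb_ext R]_z F z = \int[@leb2 R]_(z in ext) F z)%E.
Proof.
move=> mF F0.
rewrite (@ge0_integral_density _ _ _ (@leb2 R) (@leb_ext R) ext (cst 1))//.
- by apply: eq_integral => z _; rewrite mule1.
- exact: measurable_ext.
- move=> A mA.
  have mI : measurable (A `&` ext : set plane).
    by apply: measurableI => //; exact: measurable_ext.
  have := integral_cst (@leb2 R) mI 1; rewrite mul1e => I1.
  exact/esym/I1.
Qed.

Lemma integral_mu_log (F : plane -> \bar R) : measurable_fun setT F ->
  (forall z, 0 <= F z)%E ->
  (\int[@mu_log R]_z F z =
   \int[@leb2 R]_(z in ext) (F z * (1 + ln (enorm z))%:E))%E.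
Proof.
move=> mF F0; apply: ge0_integral_density => //.
- exact: measurable_ext.
- exact: measurable_log_weight.
- by move=> z /log_weight_ge1; exact: le_trans.
Qed.

Lemma measurable_lg : measurable_fun [set: plane] (fun z => lg (rsq z)).
Proof.
apply: continuous_measurable_plane => z.
apply: (@continuous_comp _ _ _ rsq lg); first exact: rsq_continuous.
exact/continuous_lg/rsq_ge0.
Qed.

Lemma integral_mu_log_le f : measurable_fun [set: plane] f -> (forall z, 0 <= f z) ->
  (\int[@mu_log R]_z (f z)%:E <= \int[@leb_ext R]_z (f z * lg (rsq z))%:E)%E.
Proof.
move=> mf f0.
have mfl : measurable_fun [set: plane] (fun z => (f z * lg (rsq z))%:E).
  by apply/measurable_EFinP; apply: measurable_funM => //; exact: measurable_lg.
have mfE : measurable_fun setT (EFin \o f : plane -> \bar R) by exact/measurable_EFinP.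
have E1 := @integral_mu_log (EFin \o f) mfE f0.
have fl0 z : (0 <= (f z * lg (rsq z))%:E)%E.
  by rewrite lee_fin mulr_ge0// ltW// lg_gt0// rsq_ge0.
have E2 := integral_leb_ext mfl fl0.
apply: (eq_ind_r (fun A => (A <= _)%E) _ E1).
apply: (eq_ind_r (fun A => (_ <= A)%E) _ E2).
apply: ge0_le_integral.
- exact: measurable_ext.
- by move=> z zext; exact: mul_log_weight_ge0.
- apply: emeasurable_funM; first exact/measurable_funTS/measurable_EFinP.
  by apply/measurable_EFinP; exact: measurable_log_weight.
- exact: measurable_funTS.
- by move=> z /log_weight_bounds/andP[w1 _]; rewrite -EFinM lee_fin ler_wpM2l.
Qed.

Lemma integral_lg_le f : measurable_fun [set: plane] f -> (forall z, 0 <= f z) ->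
  (\int[@leb_ext R]_z (f z * lg (rsq z))%:E <= 2%:E * \int[@mu_log R]_z (f z)%:E)%E.
Proof.
move=> mf f0.
have mfl : measurable_fun [set: plane] (fun z => (f z * lg (rsq z))%:E).
  by apply/measurable_EFinP; apply: measurable_funM => //; exact: measurable_lg.
have mfw : measurable_fun (ext : set plane) (fun z => (f z)%:E * (1 + ln (enorm z))%:E)%E.
  apply: emeasurable_funM; first exact/measurable_funTS/measurable_EFinP.
  by apply/measurable_EFinP; exact: measurable_log_weight.
have mfE : measurable_fun setT (EFin \o f : plane -> \bar R) by exact/measurable_EFinP.
have E1 := @integral_mu_log (EFin \o f) mfE f0.
have fl0 z : (0 <= (f z * lg (rsq z))%:E)%E.
  by rewrite lee_fin mulr_ge0// ltW// lg_gt0// rsq_ge0.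
have E2 := integral_leb_ext mfl fl0.
have fw0 z : ext z -> (0 <= (f z)%:E * (1 + ln (enorm z))%:E)%E.
  by move=> zext; exact: mul_log_weight_ge0.
apply: (eq_ind_r (fun A => (A <= _)%E) _ E2).
apply: (eq_ind_r (fun A => (_ <= _ * A)%E) _ E1).
have E3 := @ge0_integralZl _ _ _ (@leb2 R) ext measurable_ext _ mfw 2%:E fw0 (ler0n R 2).
apply: (@le_trans _ _ (\int[@leb2 R]_(z in ext)
    (2%:E * ((f z)%:E * (1 + ln (enorm z))%:E)))%E); last by rewrite E3.
apply: ge0_le_integral.
- exact: measurable_ext.
- by move=> z _; exact: fl0.
- exact: measurable_funTS.
- exact: emeasurable_funM.
- move=> z /log_weight_bounds/andP[_ w1].
  by rewrite -!EFinM lee_fin mulrCA ler_wpM2l.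
Qed.

Lemma integral_leb_ext_le (F : plane -> \bar R) : measurable_fun setT F ->
  (forall z, 0 <= F z)%E ->
  (\int[@leb_ext R]_z F z <= \int[@leb2 R]_z F z)%E.
Proof.
move=> mF F0; rewrite [leLHS]integral_leb_ext//; apply: ge0_subset_integral => //.
exact: measurable_ext.
Qed.

Lemma integral_leb2_ext (F : plane -> \bar R) : measurable_fun setT F ->
  (forall z, 0 <= F z)%E -> (forall z, rsq z <= 1 -> F z = 0%E) ->
  (\int[@leb2 R]_z F z = \int[@leb_ext R]_z F z)%E.
Proof.
move=> mF F0 Fd; rewrite [RHS]integral_leb_ext// [RHS]integral_mkcond.
apply: eq_integral => z _; rewrite patchE; case: ifPn => //.
rewrite notin_setE => zext; apply: Fd; rewrite leNgt; apply/negP => /extP.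
exact: zext.
Qed.

(** The support of [phi] is a closed subset of the open exterior, so [phi]
    vanishes near every point of the closed disc, boundary included. *)
Lemma test_fun_grad_disc phi z : test_fun phi -> rsq z <= 1 -> gradsq phi z = 0.
Proof.
move=> [_ _ sub] z1.
have nz : ~ closure [set x | phi x != 0] z.
  by move=> /sub /extP; rewrite ltNge z1.
have phi0 : \forall y \near z, phi y = cst 0 y.
  have : open (~` closure [set x | phi x != 0]) by exact/closed_openC/closed_closure.
  rewrite openE => /(_ z nz); rewrite /interior.
  apply: filterS => y /= ny; apply/eqP/negP => phiy.
  by apply: ny; apply: subset_closure; exact/negP.
rewrite /gradsq (near_eq_derive _ phi0)// (near_eq_derive _ phi0)//.
by rewrite !derive_cst expr0n/= addr0.
Qed.

Lemma rho_sqr d s : 0 <= s -> rho d s ^+ 2 = lg s * (1 + d * s)^-1 ^+ 2.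
Proof. by move=> s0; rewrite [LHS]exprMn sqr_sqrtr// ltW// lg_gt0. Qed.

(** The damped weight [rho^2] is square integrable, so [L^2] convergence entails
    convergence in the [L^1] space with this weight. *)
Lemma integral_rho4_lty d : 0 < d -> d <= 1 ->
  (\int[@leb_ext R]_z ((rho d (rsq z) ^+ 2) ^+ 2)%:E < +oo)%E.
Proof.
move=> d0 d1.
have mrho : measurable_fun [set: plane] (fun z => ((rho d (rsq z) ^+ 2) ^+ 2)%:E).
  apply/measurable_EFinP; do 2 apply: measurable_funX.
  by apply: continuous_measurable_plane; apply: rho_continuous; exact: ltW.
apply: le_lt_trans (integral_leb_ext_le mrho _) _.
  by move=> z; rewrite lee_fin sqr_ge0.
have mone : measurable_fun [set: plane] (fun z => (oneDsqr z.1 * oneDsqr z.2)^-1).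
  under eq_fun do rewrite invfM.
  have cV : measurable_fun setT (fun x : R => (oneDsqr x)^-1).
    by apply: continuous_measurable_fun; exact: continuous_oneDsqrV.
  by apply: measurable_funM; apply: (measurableT_comp cV);
    [exact: measurable_fst|exact: measurable_snd].
apply: (@le_lt_trans _ _ (\int[@leb2 R]_z (d ^- 4 * (oneDsqr z.1 * oneDsqr z.2)^-1)%:E)%E).
  apply: ge0_le_integral => //.
  - by move=> z _; rewrite lee_fin sqr_ge0.
  - by apply/measurable_EFinP; exact: measurable_funM.
  move=> z _; rewrite lee_fin rho_sqr ?rsq_ge0//.
  have s0 := rsq_ge0 z; have l0 := lg_gt0 s0; have ls := lg_le s0.
  have o0 : 0 < oneDsqr z.1 * oneDsqr z.2.
    by rewrite mulr_gt0// (lt_le_trans ltr01)// oneDsqr_ge1.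
  have os : oneDsqr z.1 * oneDsqr z.2 <= (1 + rsq z) ^+ 2.
    rewrite /oneDsqr /rsq; have := sqr_ge0 z.1; have := sqr_ge0 z.2.
    by move: (z.1 ^+ 2) (z.2 ^+ 2) => x y; nra.
  have b0 : 0 < 1 + rsq z by rewrite ltr_pwDl.
  have ds : d * (1 + rsq z) <= 1 + d * rsq z by rewrite mulrDr mulr1 lerD2r.
  have db0 : 0 < d * (1 + rsq z) by rewrite mulr_gt0.
  apply: (@le_trans _ _ (d ^- 4 * ((1 + rsq z) ^+ 2)^-1)); last first.
    by rewrite ler_wpM2l ?invr_ge0 ?exprn_ge0 ?(ltW d0)// lef_pV2 ?posrE// exprn_gt0.
  have q0 : 0 < 1 + d * rsq z by rewrite (lt_le_trans db0).
  have E : 0 <= lg (rsq z) * (1 + d * rsq z)^-1 ^+ 2 <=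
      (1 + rsq z) * (d * (1 + rsq z))^-1 ^+ 2.
    apply/andP; split; first by rewrite mulr_ge0 ?sqr_ge0// ltW.
    rewrite ler_pM ?sqr_ge0 ?(ltW l0)// ler_sqr ?nnegrE ?invr_ge0 ?(ltW q0) ?(ltW db0)//.
    by rewrite lef_pV2 ?posrE.
  move: E => /andP[E1 E2].
  apply: (le_trans (lerXn2r 2 _ _ E2)); rewrite ?nnegrE//.
    by rewrite (le_trans E1).
  rewrite le_eqVlt; apply/orP; left; apply/eqP; field.
  by rewrite !gt_eqF.
under eq_integral do rewrite EFinM.
rewrite ge0_integralZl//; last 2 first.
- exact/measurable_EFinP.
- by rewrite lee_fin invr_ge0 exprn_ge0// ltW.
by rewrite lte_mul_pinfty// ?lee_fin ?invr_ge0 ?exprn_ge0 ?(ltW d0)//; exact: integral_oneDsqrX_lty.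
Qed.

End exterior_measures.
(** * Passing to the closure of the test functions *)

Section H10_functions.
Context {R : realType}.
Local Notation plane := (measurableTypeR R * measurableTypeR R)%type.
Implicit Types (phi f : R * R -> R) (g : R * R -> R * R) (b d e t tau G N K : R).

Definition sqnorm (v : R * R) : R := v.1 ^+ 2 + v.2 ^+ 2.

Lemma Lfun_measurable (dT : measure_display) (T : measurableType dT) (mu : {measure set T -> \bar R})
  (p : \bar R) (f : T -> R) : f \in Lfun mu p -> measurable_fun setT f.
Proof. by move=> /sub_Lfun_mfun; rewrite inE. Qed.

Lemma Lnorm2_sqr (mu : {measure set plane -> \bar R}) f :
  ('N[mu]_2%:E[EFin \o f] `^ 2 = \int[mu]_z (f z ^+ 2)%:E)%E.
Proof.
rewrite poweR_Lnorm//; apply: eq_integral => z _ /=.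
by rewrite powR_mulrn// real_normK// num_real.
Qed.

Lemma L2norm_grad_sqr g :
  (L2norm_grad g `^ 2 = \int[@leb_ext R]_z (sqnorm (g z))%:E)%E.
Proof.
rewrite [LHS]Lnorm2_sqr; apply: eq_integral => z _ /=.
by rewrite sqr_sqrtr// addr_ge0// sqr_ge0.
Qed.

Lemma H10_approx f g e : H10 f -> H1_grad f g -> 0 < e ->
  exists phi, [/\ test_fun phi,
    (\int[@leb_ext R]_z ((phi z - f z) ^+ 2)%:E <= e%:E)%E &
    (\int[@leb_ext R]_z (sqnorm (grad phi z - g z))%:E <= e%:E)%E].
Proof.
move=> [_ [phi tphi cv]] fg e0; have /= {}cv := cv _ fg.
have e20 : (0 < (Num.sqrt e)%:E)%E by rewrite lte_fin sqrtr_gt0.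
have [n _ /(_ n (leqnn n)) /= Hn] := cv _ (open_ereal_lt' e20).
exists (phi n).
have : (H1norm (phi n \- f)%R (grad (phi n) \- g)%R `^ 2 <= e%:E)%E.
  rewrite -[e in leRHS](sqr_sqrtr (ltW e0)) -powR_mulrn ?sqrtr_ge0// -poweR_EFin.
  apply: gt0_ler_poweR => //; last exact: ltW.
  - by rewrite in_itv/= leey andbT poweR_ge0.
  - by rewrite in_itv/= leey andbT ltW.
have ab0 : (0 <= 'N[@leb_ext R]_2%:E[EFin \o (phi n \- f)%R] `^ 2 +
    L2norm_grad (grad (phi n) \- g)%R `^ 2)%E.
  by rewrite adde_ge0// poweR_ge0.
rewrite /H1norm -poweRrM mulVf// poweRe1// L2norm_grad_sqr Lnorm2_sqr => Hle.
split => //.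
- apply: le_trans Hle; apply: leeDl.
  by apply: integral_ge0 => z _; rewrite lee_fin addr_ge0// sqr_ge0.
- apply: le_trans Hle; apply: leeDr.
  by apply: integral_ge0 => z _; rewrite lee_fin sqr_ge0.
Qed.

Lemma sqrrD_le (x y : R) : x ^+ 2 <= 2 * (x - y) ^+ 2 + 2 * y ^+ 2.
Proof. by have := sqr_ge0 (x - 2 * y); nra. Qed.

(** Comparison of a truncated [x] with an approximation [y]: since
    [min |x| K <= |y| + min |x - y| K], an even power of the left side is
    controlled by the same power of [y] and, thanks to the truncation, by the
    first power of [|x - y|]. *)
Lemma truncation_le (k : nat) (x y K r : R) : 0 <= K ->
  (Num.min `|x| K ^+ k.+1 * r) ^+ 2 <=
  4 ^+ k.+1 * (y ^+ k.+1 * r) ^+ 2 +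
  4 ^+ k.+1 * K ^+ k.*2.+1 * `|(x - y) * r ^+ 2|.
Proof.
move=> K0; set m := Num.min _ _; set u := Num.min `|x - y| K.
have m0 : 0 <= m by rewrite le_min normr_ge0.
have u0 : 0 <= u by rewrite le_min normr_ge0.
have mE : m <= `|y| + u.
  rewrite /u /m; case: (leP `|x - y| K) => [xyK|Kxy].
    rewrite ge_min (le_trans _ (ler_normD _ _))//.
      by rewrite addrCA subrr addr0.
  by rewrite ge_min lerDr normr_ge0 orbT.
have {}mE : m <= 2 * Num.max `|y| u.
  rewrite (le_trans mE)// mulr_natl mulr2n lerD// le_max lexx ?orbT//.
have mX : (m ^+ k.+1) ^+ 2 <= 4 ^+ k.+1 * ((y ^+ k.+1) ^+ 2 + K ^+ k.*2.+1 * `|x - y|).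
  rewrite -exprM mulnC exprM.
  apply: (@le_trans _ _ ((4 * Num.max `|y| u ^+ 2) ^+ k.+1)).
    apply: lerXn2r.
    - by rewrite nnegrE sqr_ge0.
    - by rewrite nnegrE mulr_ge0 ?ler0n ?sqr_ge0.
    rewrite (_ : 4 = 2 ^+ 2); last by ring.
    by rewrite -exprMn ler_sqr ?nnegrE ?mulr_ge0// le_max normr_ge0.
  rewrite exprMn ler_wpM2l ?exprn_ge0//.
  have [yu|uy] := leP `|y| u.
    apply: (@le_trans _ _ (K ^+ k.*2.+1 * `|x - y|)); last first.
      by rewrite lerDr sqr_ge0.
    rewrite -exprM mul2n doubleS exprSr ler_pM ?exprn_ge0//.
      by apply: lerXn2r; rewrite ?nnegrE// /u ge_min lexx orbT.
    by rewrite /u ge_min lexx.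
  rewrite real_normK ?num_real// -exprM mulnC exprM lerDl.
  by rewrite mulr_ge0// exprn_ge0.
rewrite exprMn normrM (ger0_norm (sqr_ge0 r)) exprMn.
rewrite [leRHS](_ : _ = 4 ^+ k.+1 *
  ((y ^+ k.+1) ^+ 2 + K ^+ k.*2.+1 * `|x - y|) * r ^+ 2); last by ring.
by rewrite ler_wpM2r// sqr_ge0.
Qed.

End H10_functions.
Section weighted_moments.
Context {R : realType}.
Local Notation plane := (measurableTypeR R * measurableTypeR R)%type.
Implicit Types (phi f : R * R -> R) (g : R * R -> R * R) (b d e t tau G N K : R).

Lemma H1_grad_measurable f g : H1_grad f g ->
  [/\ measurable_fun [set: plane] f, measurable_fun [set: plane] (fst \o g) &
      measurable_fun [set: plane] (snd \o g)].
Proof.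
by move=> [/Lfun_measurable mf [/Lfun_measurable m1 /Lfun_measurable m2] _].
Qed.

(** The moment estimate passes from test functions to their limit once the
    function is truncated and the weight is damped: the error is linear in
    [|f - phi|] and is measured with the square integrable weight [rho^2]. *)
Lemma truncated_moment f g (k : nat) d K tau G N b :
  H10 f -> H1_grad f g -> 0 < d -> d <= 1 -> 0 <= K -> 0 < tau ->
  (\int[@leb_ext R]_z (sqnorm (g z))%:E <= G%:E)%E ->
  (\int[@leb_ext R]_z (f z ^+ 2)%:E <= N%:E)%E ->
  (\int[@leb_ext R]_z (`|f z| * lg (rsq z))%:E <= b%:E)%E ->
  2 * G + 2 * d * N < tau ^+ 2 ->
  (\int[@leb_ext R]_z ((Num.min `|f z| K ^+ k.+1 * rho d (rsq z)) ^+ 2)%:E <=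
   (4 ^+ k.+1 * (moment_const k * tau ^+ k.*2.+1 * b))%:E)%E.
Proof.
move=> hf fg d0 d1 K0 tau0 IG IN Ib GN.
have [mf mg1 mg2] := H1_grad_measurable fg.
have mrho : measurable_fun [set: plane] (fun z => rho d (rsq z)).
  by apply: continuous_measurable_plane; apply: rho_continuous; exact: ltW.
have mrho2 : measurable_fun [set: plane] (fun z => rho d (rsq z) ^+ 2).
  exact: measurable_funX.
have [V V0 IV] : exists2 V, 0 <= V &
    (\int[@leb_ext R]_z ((rho d (rsq z) ^+ 2) ^+ 2)%:E <= V%:E)%E.
  have I0 : (0 <= \int[@leb_ext R]_z ((rho d (rsq z) ^+ 2) ^+ 2)%:E)%E.
    by apply: integral_ge0 => z _; rewrite lee_fin sqr_ge0.
  exists (fine (\int[@leb_ext R]_z ((rho d (rsq z) ^+ 2) ^+ 2)%:E)%E).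
    exact: fine_ge0.
  by rewrite fineK// ge0_fin_numE// integral_rho4_lty.
pose mt := moment_const (R := R) k * tau ^+ k.*2.+1.
have mt0 : 0 < mt by rewrite mulr_gt0 ?moment_const_gt0// exprn_gt0.
have p40 : 0 < 4 ^+ k.+1 :> R by rewrite exprn_gt0.
have pK0 : 0 <= 4 ^+ k.+1 * K ^+ k.*2.+1 by rewrite mulr_ge0 ?(ltW p40)// exprn_ge0.
pose c := 4 ^+ k.+1 * mt + 4 ^+ k.+1 * K ^+ k.*2.+1.
have c0 : 0 < c by rewrite ltr_pwDl// mulr_gt0.
apply/lee_addgt0Pr => e e0.
(* eta bounds the weighted L^1 distance from f to phi, ep the squared H^1 one. *)
pose eta := e / c; have eta0 : 0 < eta by rewrite divr_gt0.
pose ep := Num.min ((tau ^+ 2 - (2 * G + 2 * d * N)) / 4) (eta ^+ 2 / (V + 1)).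
have ep0 : 0 < ep.
  rewrite lt_min divr_gt0 ?subr_gt0//= divr_gt0 ?exprn_gt0//.
  by rewrite ltr_wpDl.
have [phi [tphi If Ig]] := H10_approx hf fg ep0.
have [mphi m1 m2 mg] := test_fun_measurable tphi.
have msub : measurable_fun [set: plane] (fun z => f z - phi z) by exact: measurable_funB.
have If' : (\int[@leb_ext R]_z ((f z - phi z) ^+ 2)%:E <= ep%:E)%E.
  by under eq_integral do rewrite -sqrrN opprB.
have Idiff : (\int[@leb_ext R]_z `|(f z - phi z) * rho d (rsq z) ^+ 2|%:E <= eta%:E)%E.
  apply: le_trans (integral_CauchySchwarz msub mrho2 (ltW ep0) V0 If' IV) _.
  rewrite lee_fin -[leRHS]ger0_norm ?(ltW eta0)// -sqrtr_sqr ler_wsqrtr//.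
  apply: (@le_trans _ _ (eta ^+ 2 / (V + 1) * V)).
    by rewrite ler_wpM2r// /ep ge_min lexx orbT.
  rewrite mulrAC ler_pdivrMr ?ltr_wpDl// ler_wpM2l ?sqr_ge0// lerDl//.
have mdiff : measurable_fun [set: plane]
    (fun z => `|(f z - phi z) * rho d (rsq z) ^+ 2|).
  by apply: measurableT_comp => //; exact: measurable_funM.
have mflg : measurable_fun [set: plane] (fun z => `|f z| * lg (rsq z)).
  by apply: measurable_funM; [exact: measurableT_comp|exact: measurable_lg].
have lg0 z : 0 <= lg (rsq (z : R * R)) by rewrite ltW// lg_gt0// rsq_ge0.
have flg0 z : 0 <= `|f z| * lg (rsq z) by rewrite mulr_ge0.
have mphir : measurable_fun [set: plane] (fun z => `|phi z| * rho d (rsq z) ^+ 2).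
  by apply: measurable_funM => //; exact: measurableT_comp.
have Iphi : (\int[@leb2 R]_z (`|phi z| * rho d (rsq z) ^+ 2)%:E <= (b + eta)%:E)%E.
  rewrite (@integral_leb2_ext _ (fun z => (`|phi z| * rho d (rsq z) ^+ 2)%:E)).
  - have := ge0_integral_lin2_le ler01 ler01 mflg mdiff flg0 (fun z => normr_ge0 _) Ib Idiff.
    rewrite !mul1r; apply: le_trans; apply: ge0_le_integral_EFin => //.
    + by apply: measurable_funD; exact: measurable_funM.
    + by move=> z; rewrite mulr_ge0 ?sqr_ge0.
    move=> z; rewrite !mul1r normrM (ger0_norm (sqr_ge0 _)).
    apply: (@le_trans _ _ ((`|f z| + `|f z - phi z|) * rho d (rsq z) ^+ 2)).
      rewrite ler_wpM2r ?sqr_ge0//.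
      have := ler_normB (f z) (f z - phi z).
      by rewrite [f z - (f z - phi z)](_ : _ = phi z)//; ring.
    rewrite mulrDl lerD2r ler_wpM2l// rho_sqr ?rsq_ge0//.
    have ds0 : 0 <= d * rsq z by rewrite mulr_ge0 ?rsq_ge0// ltW.
    have q0 : 0 < 1 + d * rsq z by rewrite ltr_pwDl.
    rewrite -[leRHS]mulr1 ler_wpM2l//; apply: exprn_ile1; first by rewrite invr_ge0 ltW.
    by rewrite invf_le1// lerDl.
  - exact/measurable_EFinP.
  - by move=> z; rewrite lee_fin mulr_ge0 ?sqr_ge0.
  - by move=> z z1; rewrite (test_fun_disc tphi z1) normr0 mul0r.
have Iphi2 : (\int[@leb2 R]_z (phi z ^+ 2)%:E <= (2 * ep + 2 * N)%:E)%E.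
  have mp2 : measurable_fun [set: plane] (fun z => phi z ^+ 2) by exact: measurable_funX.
  have ms2 : measurable_fun [set: plane] (fun z => (phi z - f z) ^+ 2).
    by apply: measurable_funX; exact: measurable_funB.
  have mf2 : measurable_fun [set: plane] (fun z => f z ^+ 2) by exact: measurable_funX.
  rewrite (@integral_leb2_ext _ (fun z => (phi z ^+ 2)%:E)).
  - have := ge0_integral_lin2_le (ler0n R 2) (ler0n R 2) ms2 mf2
      (fun z => sqr_ge0 _) (fun z => sqr_ge0 _) If IN.
    apply: le_trans; apply: ge0_le_integral_EFin => //.
    + by apply: measurable_funD; exact: measurable_funM.
    + by move=> z; rewrite sqr_ge0.
    + by move=> z; exact: sqrrD_le.
  - exact/measurable_EFinP.
  - by move=> z; rewrite lee_fin sqr_ge0.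
  - by move=> z z1; rewrite (test_fun_disc tphi z1) expr0n.
have sq0 (v : R * R) : 0 <= sqnorm v by rewrite addr_ge0// sqr_ge0.
have Igrad : (\int[@leb2 R]_z (gradsq phi z)%:E <= (2 * ep + 2 * G)%:E)%E.
  have ms : measurable_fun [set: plane] (fun z => sqnorm (grad phi z - g z)).
    by apply: measurable_funD; apply: measurable_funX; exact: measurable_funB.
  have msg : measurable_fun [set: plane] (fun z => sqnorm (g z)).
    by apply: measurable_funD; exact: measurable_funX.
  rewrite (@integral_leb2_ext _ (fun z => (gradsq phi z)%:E)).
  - have := ge0_integral_lin2_le (ler0n R 2) (ler0n R 2) ms msg
      (fun z => sq0 _) (fun z => sq0 _) Ig IG.
    apply: le_trans; apply: ge0_le_integral_EFin => //.
    + by apply: measurable_funD; exact: measurable_funM.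
    + by move=> z; exact: gradsq_ge0.
    move=> z; rewrite /gradsq /sqnorm /grad/=.
    have := sqrrD_le ('D_e1 phi z) (g z).1; have := sqrrD_le ('D_e2 phi z) (g z).2.
    move: (('D_e1 phi z - _) ^+ 2) (('D_e2 phi z - _) ^+ 2) ((g z).1 ^+ 2) ((g z).2 ^+ 2).
    move: ('D_e1 phi z ^+ 2) ('D_e2 phi z ^+ 2) => *; lra.
  - exact/measurable_EFinP.
  - by move=> z; rewrite lee_fin gradsq_ge0.
  - by move=> z z1; rewrite (test_fun_grad_disc tphi z1).
have Htau : 2 * ep + 2 * G + d * (2 * ep + 2 * N) <= tau ^+ 2.
  have : ep <= (tau ^+ 2 - (2 * G + 2 * d * N)) / 4 by rewrite /ep ge_min lexx.
  have : d * ep <= ep by rewrite ler_piMl// ltW.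
  rewrite mulrDr mulrCA [d * (2 * N)]mulrCA -[2 * d * N]mulrA.
  by move: (d * ep) (d * N) (tau ^+ 2) => de dN t2; lra.
have Ik := test_fun_moment k tphi (ltW d0) tau0 Igrad Iphi2 Htau Iphi.
have mk : measurable_fun [set: plane] (fun z => (phi z ^+ k.+1 * rho d (rsq z)) ^+ 2).
  by apply: measurable_funX; apply: measurable_funM => //; exact: measurable_funX.
have Ik' : (\int[@leb_ext R]_z ((phi z ^+ k.+1 * rho d (rsq z)) ^+ 2)%:E <=
    (mt * (b + eta))%:E)%E.
  apply: le_trans Ik; apply: (@integral_leb_ext_le _ (fun z => ((phi z ^+ k.+1 * rho d (rsq z)) ^+ 2)%:E)).
    exact/measurable_EFinP.
  by move=> z; rewrite lee_fin sqr_ge0.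
have := ge0_integral_lin2_le (ltW p40) pK0 mk mdiff (fun z => sqr_ge0 _)
  (fun z => normr_ge0 _) Ik' Idiff.
rewrite (_ : 4 ^+ k.+1 * (mt * (b + eta)) + 4 ^+ k.+1 * K ^+ k.*2.+1 * eta =
   4 ^+ k.+1 * (mt * b) + e); last first.
  rewrite (_ : e = c * eta); last by rewrite /eta mulrC divfK// gt_eqF.
  by rewrite /c; ring.
rewrite EFinD; apply: le_trans; apply: ge0_le_integral_EFin.
- apply: measurable_funX; apply: measurable_funM => //; apply: measurable_funX.
  by apply: measurable_minr => //; exact: measurableT_comp.
- by apply: measurable_funD; exact: measurable_funM.
- by move=> z; rewrite sqr_ge0.
- by move=> z; exact: truncation_le.
Qed.

End weighted_moments.
(** * Interpolation *)

Section interpolation.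
Context {R : realType}.
Local Notation plane := (measurableTypeR R * measurableTypeR R)%type.
Implicit Types (f : R * R -> R) (g : R * R -> R * R) (b t tau G N M q : R).

(** Truncation height [n] and damping [1/(n+1)]: both truncation and damping
    are removed by a single monotone limit. *)
Lemma weighted_moment f g (k : nat) tau G N b :
  H10 f -> H1_grad f g -> 0 < tau ->
  (\int[@leb_ext R]_z (sqnorm (g z))%:E <= G%:E)%E ->
  (\int[@leb_ext R]_z (f z ^+ 2)%:E <= N%:E)%E ->
  (\int[@leb_ext R]_z (`|f z| * lg (rsq z))%:E <= b%:E)%E ->
  2 * G < tau ^+ 2 ->
  (\int[@leb_ext R]_z ((`|f z| ^+ k.+1) ^+ 2 * lg (rsq z))%:E <=
   (4 ^+ k.+1 * (moment_const k * tau ^+ k.*2.+1 * b))%:E)%E.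
Proof.
move=> hf fg tau0 IG IN Ib GN.
have [mf _ _] := H1_grad_measurable fg.
pose F n (z : plane) := (Num.min `|f z| n%:R ^+ k.+1 * rho (n.+1%:R^-1) (rsq z)) ^+ 2.
have d0 n : 0 < n.+1%:R^-1 :> R by rewrite invr_gt0.
have d1 n : n.+1%:R^-1 <= 1 :> R by rewrite invf_le1// ler1n.
have FE n z : F n z = (Num.min `|f z| n%:R ^+ k.+1) ^+ 2 *
    (lg (rsq z) * (1 + n.+1%:R^-1 * rsq z)^-1 ^+ 2).
  by rewrite /F exprMn rho_sqr// rsq_ge0.
have mF n : measurable_fun setT (F n).
  apply: measurable_funX; apply: measurable_funM.
    apply: measurable_funX; apply: measurable_minr => //; exact: measurableT_comp.
  by apply: continuous_measurable_plane; apply: rho_continuous; exact: ltW.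
have ndF z : nondecreasing_seq (fun n => (F n z)%:E).
  move=> m n mn; rewrite lee_fin !FE; have s0 := rsq_ge0 z.
  have l0 := ltW (lg_gt0 s0).
  have q0 j : 0 < 1 + j.+1%:R^-1 * rsq z by rewrite ltr_pwDl// mulr_ge0// ltW.
  have i0 j : 0 <= (1 + j.+1%:R^-1 * rsq z)^-1 by rewrite invr_ge0 ltW.
  have m0 j : 0 <= Num.min `|f z| j%:R by rewrite le_min normr_ge0 ler0n.
  apply: ler_pM; rewrite ?sqr_ge0//.
  - by apply: mulr_ge0 => //; exact: sqr_ge0.
  - rewrite ler_sqr ?nnegrE ?exprn_ge0//; apply: lerXn2r; rewrite ?nnegrE//.
    by rewrite le_min ge_min lexx/= ge_min ler_nat mn orbT.
  - rewrite ler_wpM2l// ler_sqr ?nnegrE// lef_pV2 ?posrE//.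
    by rewrite lerD2l ler_wpM2r// lef_pV2 ?posrE// ler_nat.
have cvF z : (F n z)%:E @[n --> \oo] --> ((`|f z| ^+ k.+1) ^+ 2 * lg (rsq z))%:E.
  apply: cvg_EFin; first exact: nearW.
  rewrite -[X in _ --> X]mulr1 -mulrA.
  have inv1 : (1 + n.+1%:R^-1 * rsq z)^-1 ^+ 2 @[n --> \oo] --> (1 : R).
    rewrite [X in _ --> X](_ : _ = (1 + 0 * rsq z)^-1 ^+ 2); last first.
      by rewrite mul0r addr0 invr1 expr1n.
    apply: (@continuous_cvg _ _ _ _ _ _ (fun x : R => x ^+ 2)).
      exact: exprn_continuous.
    apply: cvgV; first by rewrite mul0r addr0 oner_neq0.
    apply: cvgD; first exact: cvg_cst.
    apply: cvgM; last exact: cvg_cst.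
    exact: cvg_harmonic.
  have E : (\forall n \near \oo, (`|f z| ^+ k.+1) ^+ 2 *
      (lg (rsq z) * (1 + n.+1%:R^-1 * rsq z)^-1 ^+ 2) = (fine \o (fun n => (F n z)%:E)) n).
    near=> n; rewrite /= FE; congr (_ ^+ _ ^+ _ * _); apply/esym/min_idPl.
    near: n; exact: nbhs_infty_ger.
  apply: (cvg_trans (near_eq_cvg E)); apply: cvgM; first exact: cvg_cst.
  by apply: cvgM; [exact: cvg_cst|exact: inv1].
have F0 n z : (0 <= (F n z)%:E)%E by rewrite lee_fin sqr_ge0.
have := @cvg_monotone_convergence _ _ _ (@leb_ext R) setT measurableT
  (fun n z => (F n z)%:E) (fun n => (measurable_EFinP _ _).2 (mF n))
  (fun n z _ => F0 n z) (fun z _ => ndF z).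
under eq_integral => z _ do rewrite (cvg_lim (@ereal_hausdorff _) (cvF z)).
move=> cv; apply: (cvge_to_le cv).
have : (2 * G + 2 * n.+1%:R^-1 * N) @[n --> \oo] --> 2 * G + 2 * 0 * N.
  apply: cvgD; first exact: cvg_cst.
  apply: cvgM; last exact: cvg_cst.
  by apply: cvgM; [exact: cvg_cst|exact: cvg_harmonic].
rewrite mulr0 mul0r addr0.
move=> /cvgr_lt /(_ _ GN); apply: filterS => n GNn.
exact: (truncated_moment k hf fg (d0 n) (d1 n) (ler0n R n) tau0 IG IN Ib GNn).
Unshelve. all: by end_near. Qed.

(** One of the two terms on the right dominates according to the sign of
    [x - t]. *)
Lemma powR_interpolation (x t q : R) (n : nat) : 0 <= x -> 0 < t -> 1 < q ->
  q <= n%:R -> x `^ q <= t `^ (q - 1) * x + t `^ (q - n%:R) * x ^+ n.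
Proof.
move=> x0 t0 q1 qn; have q0 : 0 < q by rewrite (lt_trans ltr01).
have [xt|tx] := leP x t.
  rewrite -(mulr_powRB1 x0 q0) mulrC.
  apply: (@le_trans _ _ (t `^ (q - 1) * x)).
    rewrite ler_wpM2r// ge0_ler_powR// ?nnegrE ?(ltW t0)// subr_ge0 ltW//.
  by rewrite lerDl mulr_ge0 ?powR_ge0// exprn_ge0.
have x1 : 0 < x by rewrite (lt_trans t0).
apply: (@le_trans _ _ (t `^ (q - n%:R) * x ^+ n)); last first.
  by rewrite lerDr mulr_ge0 ?powR_ge0.
rewrite -powR_mulrn// -{1}(subrK n%:R q) [x `^ (_ + n%:R)]powRD; last by rewrite (gt_eqF x1) implybT.
rewrite ler_wpM2r ?powR_ge0// -opprB !powRN lef_pV2 ?posrE ?powR_gt0//.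
by rewrite ge0_ler_powR ?nnegrE ?subr_ge0// ltW.
Qed.

Definition interpolation_const (k : nat) : R := 1 + 2 * (4 ^+ k.+1 * moment_const k).

Lemma interpolation_const_gt0 k : 0 < interpolation_const k.
Proof.
rewrite ltr_pwDl// mulr_ge0// mulr_ge0 ?exprn_ge0//.
by rewrite ltW// moment_const_gt0.
Qed.

Lemma integral_powR_mu_log_le f g (k : nat) q tau G N M :
  H10 f -> H1_grad f g -> 0 < tau -> 1 < q -> q <= (k.+1 * 2)%:R ->
  (\int[@leb_ext R]_z (sqnorm (g z))%:E <= G%:E)%E ->
  (\int[@leb_ext R]_z (f z ^+ 2)%:E <= N%:E)%E ->
  (\int[@mu_log R]_z `|f z|%:E <= M%:E)%E ->
  2 * G < tau ^+ 2 ->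
  (\int[@mu_log R]_z (`|f z| `^ q)%:E <=
    (interpolation_const k * (tau `^ (q - 1) * M))%:E)%E.
Proof.
move=> hf fg tau0 q1 qk IG IN IM GN.
have [mf _ _] := H1_grad_measurable fg.
have mabs : measurable_fun [set: plane] (fun z => `|f z|) by exact: measurableT_comp.
have Ib : (\int[@leb_ext R]_z (`|f z| * lg (rsq z))%:E <= (2 * M)%:E)%E.
  apply: le_trans (integral_lg_le mabs (fun z => normr_ge0 _)) _.
  by rewrite EFinM lee_wpmul2l// lee_fin.
have Imom := weighted_moment k hf fg tau0 IG IN Ib GN.
have mmom : measurable_fun [set: plane] (fun z => (`|f z| ^+ k.+1) ^+ 2).
  by do 2 apply: measurable_funX.
have {}Imom := le_trans (integral_mu_log_le mmom (fun z => sqr_ge0 _)) Imom.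
have t1 : 0 <= tau `^ (q - 1) by exact: powR_ge0.
have t2 : 0 <= tau `^ (q - (k.+1 * 2)%:R) by exact: powR_ge0.
have := ge0_integral_lin2_le t1 t2 mabs mmom (fun z => normr_ge0 _)
  (fun z => sqr_ge0 _) IM Imom.
rewrite [X in (_ <= X%:E)%E -> _](_ : _ =
    interpolation_const k * (tau `^ (q - 1) * M)); last first.
  have -> : tau `^ (q - 1) = tau `^ (q - (k.+1 * 2)%:R) * tau ^+ k.*2.+1.
    rewrite -powR_mulrn ?(ltW tau0)// -powRD; last by rewrite (gt_eqF tau0) implybT.
    congr (_ `^ _); rewrite muln2 doubleS -[k.*2.+2]addn1 natrD; ring.
  by rewrite /interpolation_const; ring.
apply: le_trans; apply: ge0_le_integral => //.
- apply/measurable_EFinP.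
  by apply: (@measurableT_comp _ _ _ _ _ _ (@powR R ^~ q)).
- by apply/measurable_EFinP; apply: measurable_funD; exact: measurable_funM.
by move=> z _; rewrite lee_fin -exprM; exact: powR_interpolation.
Qed.

Lemma Lfun_Lnorm_lty (dT : measure_display) (T : measurableType dT)
  (mu : {measure set T -> \bar R}) (p : \bar R) (f : T -> R) :
  f \in Lfun mu p <-> measurable_fun setT f /\ ('N[mu]_p[EFin \o f] < +oo)%E.
Proof.
split=> [/andP[]|[mf Nf]].
  by rewrite !inE => mf; rewrite /finite_norm.
by apply/andP; split; rewrite inE.
Qed.

Lemma L2norm_grad_fin_num f g : H1_grad f g -> L2norm_grad g \is a fin_num.
Proof.
move=> [_ [Lg1 Lg2] _].
have L0 : (0 <= L2norm_grad g)%E by exact: Lnorm_ge0.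
rewrite ge0_fin_numE//; apply: (@lty_poweRy _ _ 2) => //; rewrite L2norm_grad_sqr.
have := integrableD measurableT (Lfun2_integrable_sqr Lg1) (Lfun2_integrable_sqr Lg2).
move=> /integrableP[_]; under eq_integral => z _.
  rewrite /= ger0_norm; last by rewrite addr_ge0// sqr_ge0.
  over.
exact.
Qed.

Lemma weighted_interpolation f g (k : nat) q :
  1 < q -> q <= (k.+1 * 2)%:R ->
  H10 f -> f \in Lfun mu_log 1%:E -> H1_grad f g ->
  ('N[mu_log]_q%:E[EFin \o f] <=
     ((interpolation_const k * 2 `^ (q - 1)) `^ q^-1)%:E * L2norm_grad g `^ (1 - q^-1)
       * 'N[mu_log]_1%:E[EFin \o f] `^ q^-1)%E.
Proof.
move=> q1 qk hf /Lfun_Lnorm_lty[mf Nf] fg.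
have q0 : 0 < q by rewrite (lt_trans ltr01).
have [Lf _ _] := fg.
have [M M0 ME] : exists2 M, 0 <= M & ('N[mu_log]_1%:E[EFin \o f] = M%:E)%E.
  exists (fine ('N[mu_log]_1%:E[EFin \o f])%E); first by rewrite fine_ge0// Lnorm_ge0.
  by rewrite fineK// ge0_fin_numE// Lnorm_ge0.
have IM : (\int[@mu_log R]_z `|f z|%:E <= M%:E)%E by rewrite -ME Lnorm1.
have IN := Lfun2_integrable_sqr Lf.
have [N NE] : exists N, (\int[@leb_ext R]_z (f z ^+ 2)%:E <= N%:E)%E.
  by exists (fine (\int[@leb_ext R]_z (f z ^+ 2)%:E)%E); rewrite fineK// integrable_fin_num.
have [s s0 sE] : exists2 s, 0 <= s & L2norm_grad g = s%:E.
  have L0 : (0 <= L2norm_grad g)%E by exact: Lnorm_ge0.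
  exists (fine (L2norm_grad g)); first exact: fine_ge0.
  by rewrite fineK// (L2norm_grad_fin_num fg).
have IG : (\int[@leb_ext R]_z (sqnorm (g z))%:E <= (s ^+ 2)%:E)%E.
  by rewrite -L2norm_grad_sqr sE poweR_EFin powR_mulrn.
have main t : 0 < t -> 2 * s ^+ 2 < t ^+ 2 ->
    (\int[@mu_log R]_z (`|f z| `^ q)%:E <=
      (interpolation_const k * (t `^ (q - 1) * M))%:E)%E.
  by move=> t0 st; exact: (integral_powR_mu_log_le hf fg t0 q1 qk IG NE IM st).
have D0 := interpolation_const_gt0 k.
have I0 : (0 <= \int[@mu_log R]_z (`|f z| `^ q)%:E)%E.
  by apply: integral_ge0 => z _; rewrite lee_fin powR_ge0.
have -> : ('N[mu_log]_q%:E[EFin \o f] = (\int[@mu_log R]_z (`|f z| `^ q)%:E) `^ q^-1)%E.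
  by rewrite unlock.
rewrite ME sE !poweR_EFin -!EFinM.
(* The admissible tau are those above sqrt 2 * s; tau = 2 s is taken when s > 0,
   while for s = 0 letting tau tend to 0 shows that the left side is zero. *)
have [s_gt0|] := ltP 0 s.
  have s20 : 0 < 2 * s by rewrite mulr_gt0.
  have ss : 2 * s ^+ 2 < (2 * s) ^+ 2.
    by rewrite exprMn ltr_pM2r ?exprn_gt0//; lra.
  have q10 : 0 <= q^-1 by rewrite invr_ge0 ltW.
  apply: (@le_trans _ _ ((interpolation_const k * ((2 * s) `^ (q - 1) * M))%:E `^ q^-1)%E).
    apply: gt0_ler_poweR => //; last exact: main.
    - by rewrite in_itv/= leey andbT.
    - rewrite in_itv/= leey andbT lee_fin mulr_ge0 ?(ltW D0)//.
      by rewrite mulr_ge0 ?powR_ge0.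
  rewrite poweR_EFin lee_fin le_eqVlt; apply/orP; left; apply/eqP.
  rewrite [X in X `^ _ = _](_ : _ =
    (interpolation_const k * 2 `^ (q - 1)) * s `^ (q - 1) * M); last first.
    by rewrite powRM//; ring.
  rewrite powRM ?powR_ge0//; last by rewrite !mulr_ge0 ?powR_ge0 ?(ltW D0).
  rewrite powRM ?powR_ge0//; last by rewrite mulr_ge0 ?powR_ge0 ?(ltW D0).
  congr (_ * _ * _); rewrite -powRrM; congr (_ `^ _).
  by rewrite mulrBl mul1r mulfV// gt_eqF.
move=> s_le0; have {s0 s_le0} s_eq0 : s = 0 by apply/eqP; rewrite eq_le s_le0.
have -> : (\int[@mu_log R]_z (`|f z| `^ q)%:E = 0)%E.
  apply/eqP; rewrite eq_le I0 andbT; apply/lee_addgt0Pr => e e0; rewrite add0e.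
  pose a := interpolation_const k * M + 1.
  have a0 : 0 < a by rewrite ltr_wpDl// mulr_ge0// ltW.
  pose t := (e / a) `^ (q - 1)^-1.
  have t0 : 0 < t by rewrite powR_gt0// divr_gt0.
  apply: le_trans (main t t0 _) _.
    by rewrite s_eq0 expr0n mulr0 exprn_gt0.
  rewrite lee_fin /t -powRrM mulVf ?subr_eq0 ?gt_eqF// powRr1 ?divr_ge0 ?(ltW e0) ?(ltW a0)//.
  rewrite [leLHS](_ : _ = e * (interpolation_const k * M) / a); last by ring.
  by rewrite ler_pdivrMr// ler_wpM2l ?(ltW e0)// /a lerDl.
rewrite poweR0r ?invr_eq0 ?gt_eqF// lee_fin.
by rewrite !mulr_ge0 ?powR_ge0.
Qed.

End interpolation.

Theorem lemma4p3 (R : realType) (q : R) (q1 : 1 < q) :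
  (forall f : R * R -> R,
     H10 f -> f \in Lfun mu_log 1%:E -> f \in Lfun mu_log q%:E) /\
  exists2 C : R, 0 < C &
    forall (f : R * R -> R) (g : R * R -> R * R),
      H10 f -> f \in Lfun mu_log 1%:E -> H1_grad f g ->
      ('N[mu_log]_q%:E[EFin \o f] <=
         C%:E * L2norm_grad g `^ (1 - q^-1)
              * 'N[mu_log]_1%:E[EFin \o f] `^ q^-1)%E.
Proof.
have q0 : 0 < q by rewrite (lt_trans ltr01).
pose k := Num.truncn q.
have qk : q <= (k.+1 * 2)%:R.
  apply: (@le_trans _ _ k.+1%:R); first exact/ltW/truncnS_gt.
  by rewrite ler_nat leq_pmulr.
split; last first.
  exists ((interpolation_const k * 2 `^ (q - 1)) `^ q^-1).
    by rewrite powR_gt0// mulr_gt0 ?interpolation_const_gt0// powR_gt0.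
  by move=> f g hf f1 fg; exact: weighted_interpolation.
move=> f hf f1; have [[g fg] _] := hf.
have /Lfun_Lnorm_lty[mf Nf] := f1.
apply/Lfun_Lnorm_lty; split => //.
apply: le_lt_trans (weighted_interpolation q1 qk hf f1 fg) _.
rewrite lte_mul_pinfty ?mule_ge0 ?poweR_ge0 ?lee_fin ?powR_ge0//.
  by rewrite fin_numM// fin_num_poweR// (L2norm_grad_fin_num fg).
exact: poweR_lty.
Qed.
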